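(* Let $M$ be the set of all rectangles in $\mathbb{R}^2$. Let $\bar p_0=(p_1^0,p_2^0)$ and $\bar p_1=(p_1^1,p_2^1)$ satisfy $1<p_i^0<p_i^1<\infty$ for $i=1,2$. Let $\bar q_0=(q_1^0,q_2^0)$, $\bar q=(q_1,q_2)$, $\bar q_1=(q_1^1,q_2^1)$ have all components in $[1,\infty]$, and let $\bar\theta=(\theta_1,\theta_2)$ with $0<\theta_i<1$ for $i=1,2$. Define $\bar p=(p_1,p_2)$ by $$\frac{1}{p_i}=\frac{1-\theta_i}{p_i^0}+\frac{\theta_i}{p_i^1},\qquad i=1,2.$$ Then $$\left(N_{\bar p_0,\bar q_0}(M),\,N_{\bar p_1,\bar q_1}(M)\right)_{\bar\theta,\bar q}=N_{\bar p,\bar q}(M),$$ that is, the two spaces coincide as sets of functions and their norms are equivalent.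
   Context: A segment is a bounded closed interval of positive length in $\mathbb{R}$, and $|I|$ denotes the length of a segment $I$. $M$ is the set of all rectangles $Q=Q_1\times Q_2\subset\mathbb{R}^2$, where $Q_1,Q_2$ are segments. Functions are identified when equal almost everywhere. For a function $f(x_1,x_2)$ on $\mathbb{R}^2$ integrable on every $Q\in M$, define for $t_1,t_2>0$ $$\bar f(t_1,t_2;M)=\sup_{Q_1\times Q_2\in M,\ |Q_1|\ge t_1,\ |Q_2|\ge t_2}\frac{1}{|Q_1||Q_2|}\left|\int_{Q_1}\int_{Q_2}f(x_1,x_2)\,dx_1dx_2\right|.$$ Anisotropic net spaces: for $\bar p=(p_1,p_2)$ with $0<p_i<\infty$ and $\bar q=(q_1,q_2)$ with $0<q_i\le\infty$, $N_{\bar p,\bar q}(M)$ is the set of all such functions $f$ with $$\|f\|_{N_{\bar p,\bar q}(M)}=\left(\int_0^\infty\left(\int_0^\infty\left(t_1^{1/p_1}t_2^{1/p_2}\bar f(t_1,t_2;M)\right)^{q_1}\frac{dt_1}{t_1}\right)^{q_2/q_1}\frac{dt_2}{t_2}\right)^{1/q_2}<\infty .$$ Here and below, when $q=\infty$, the expression $\left(\int_0^\infty(\varphi(t))^q\frac{dt}{t}\right)^{1/q}$ is understood as $\sup_{t>0}\varphi(t)$. Interpolation method: let $E=\{\varepsilon=(\varepsilon_1,\varepsilon_2):\varepsilon_i\in\{0,1\},\ i=1,2\}$. For the pair $\mathbf A_0=N_{\bar p_0,\bar q_0}(M)$, $\mathbf A_1=N_{\bar p_1,\bar q_1}(M)$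 and $\varepsilon\in E$, let $$\mathbf A_\varepsilon=N_{(p_1^{\varepsilon_1},p_2^{\varepsilon_2}),\,(q_1^{\varepsilon_1},q_2^{\varepsilon_2})}(M).$$ For $a\in\sum_{\varepsilon\in E}\mathbf A_\varepsilon$ and $t=(t_1,t_2)$ with $t_1,t_2>0$, put $t^\varepsilon=t_1^{\varepsilon_1}t_2^{\varepsilon_2}$ and $$K(t_1,t_2)=K(t,a;\mathbf A_0,\mathbf A_1)=\inf\left\{\sum_{\varepsilon\in E}t^\varepsilon\|a_\varepsilon\|_{\mathbf A_\varepsilon}:\ a=\sum_{\varepsilon\in E}a_\varepsilon,\ a_\varepsilon\in\mathbf A_\varepsilon\right\}.$$ Then $(\mathbf A_0,\mathbf A_1)_{\bar\theta,\bar q}$ is the set of all $a\in\sum_{\varepsilon\in E}\mathbf A_\varepsilon$ for which $$\|a\|_{(\mathbf A_0,\mathbf A_1)_{\bar\theta,\bar q}}=\left(\int_0^\infty\left(\int_0^\infty\left(t_1^{-\theta_1}t_2^{-\theta_2}K(t_1,t_2)\right)^{q_1}\frac{dt_1}{t_1}\right)^{q_2/q_1}\frac{dt_2}{t_2}\right)^{1/q_2}<\infty .$$ *)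

(* Defs.v *)
From HB Require Import structures.
From mathcomp Require Import all_boot all_order all_algebra.
From mathcomp Require Import all_classical all_reals all_analysis.

Set Implicit Arguments.
Unset Strict Implicit.
Unset Printing Implicit Defensive.

Import Order.TTheory GRing.Theory Num.Theory.
Import numFieldNormedType.Exports.

Local Open Scope classical_set_scope.
Local Open Scope ring_scope.

Notation plane R := (measurableTypeR R * measurableTypeR R)%type.

Notation lebesgue2 R := (@lebesgue_measure R \x @lebesgue_measure R)%E.

Record segment (R : realType) := Segment {
  seg_lo : R;
  seg_hi : R;
  seg_lt : seg_lo < seg_hi
}.

Definition seg_set (R : realType) (I : segment R) : set (measurableTypeR R) :=
  `[seg_lo I, seg_hi I].

Definition seg_length (R : realType) (I : segment R) : R :=
  seg_hi I - seg_lo I.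

(* The set M of all rectangles Q1 x Q2 is the type segment R * segment R. *)
Definition rect_set (R : realType) (Q : segment R * segment R)
    : set (plane R) :=
  seg_set Q.1 `*` seg_set Q.2.

(* Functions on the plane are Borel measurable: every class modulo equality
   almost everywhere of Lebesgue measurable functions contains one. *)
Definition integrable_on_rects (R : realType) (f : {mfun plane R >-> R})
    : Prop :=
  forall Q : segment R * segment R,
    (lebesgue2 R).-integrable (rect_set Q) (EFin \o f).

Definition net_avg (R : realType) (f : {mfun plane R >-> R}) (t1 t2 : R)
    : \bar R :=
  ereal_sup
    [set ((seg_length Q.1 * seg_length Q.2)^-1%:E *
          `| \int[lebesgue2 R]_(x in rect_set Q) (f x)%:E |)%E
    | Q in [set Q : segment R * segment R |
             t1 <= seg_length Q.1 /\ t2 <= seg_length Q.2]].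

(* (\int_0^oo (phi t)^q dt/t)^(1/q), and \sup_(t > 0) phi t for q = +oo.
   The value at q = -oo is irrelevant. *)
Definition dtt_norm (R : realType) (q : \bar R) (phi : R -> \bar R) : \bar R :=
  match q with
  | r%:E => poweR
      (\int[@lebesgue_measure R]_(t in `]0%R, +oo[)
         (poweR (phi t) r * t^-1%:E))%E r^-1
  | +oo%E => ereal_sup [set phi t | t in `]0, +oo[]
  | -oo%E => 0%E
  end.

(* Inner norm in t1, outer norm in t2: the exponent q2/q1 of the inner integral
   is split as (1/q1) * q2, which is what gives a meaning to q1 = +oo. *)
Definition dtt_norm2 (R : realType) (q : \bar R * \bar R)
    (phi : R -> R -> \bar R) : \bar R :=
  dtt_norm q.2 (fun t2 => dtt_norm q.1 (fun t1 => phi t1 t2)).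

Definition net_norm (R : realType) (p : R * R) (q : \bar R * \bar R)
    (f : {mfun plane R >-> R}) : \bar R :=
  dtt_norm2 q (fun t1 t2 =>
    ((t1 `^ (p.1)^-1 * t2 `^ (p.2)^-1)%:E * net_avg f t1 t2)%E).

Definition net_space (R : realType) (p : R * R) (q : \bar R * \bar R)
    : set {mfun plane R >-> R} :=
  [set f | integrable_on_rects f /\ (net_norm p q f < +oo)%E].

(* E = {0,1}^2 is encoded as bool * bool; mix e x0 x1 is
   (x_1^(e_1), x_2^(e_2)). *)
Definition mix (T : Type) (e : bool * bool) (x0 x1 : T * T) : T * T :=
  (if e.1 then x1.1 else x0.1, if e.2 then x1.2 else x0.2).

Section Interpolation.
Variables (R : realType) (p0 p1 : R * R) (q0 q1 : \bar R * \bar R).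

Definition decomposition (a : {mfun plane R >-> R})
    (b : bool * bool -> {mfun plane R >-> R}) : Prop :=
  (forall e, net_space (mix e p0 p1) (mix e q0 q1) (b e)) /\
  {ae lebesgue2 R, forall x, a x = \sum_(e : bool * bool) b e x}.

Definition sum_space : set {mfun plane R >-> R} :=
  [set a | exists b, decomposition a b].

Definition K_functional (a : {mfun plane R >-> R}) (t1 t2 : R) : \bar R :=
  ereal_inf
    [set (\sum_(e : bool * bool)
            (t1 ^+ e.1 * t2 ^+ e.2)%:E
              * net_norm (mix e p0 p1) (mix e q0 q1) (b e))%E
    | b in decomposition a].

Definition interp_norm (theta : R * R) (q : \bar R * \bar R)
    (a : {mfun plane R >-> R}) : \bar R :=
  dtt_norm2 q (fun t1 t2 =>
    ((t1 `^ (- theta.1) * t2 `^ (- theta.2))%:E * K_functional a t1 t2)%E).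

Definition interp_space (theta : R * R) (q : \bar R * \bar R)
    : set {mfun plane R >-> R} :=
  [set a | sum_space a /\ (interp_norm theta q a < +oo)%E].

End Interpolation.

Definition equivalent_norms (R : realType) (X : Type) (A : set X)
    (N1 N2 : X -> \bar R) : Prop :=
  exists c C : R, [/\ 0 < c, 0 < C &
    forall a, A a -> (c%:E * N1 a <= N2 a)%E /\ (N2 a <= C%:E * N1 a)%E].

(* Main.v *)
From HB Require Import structures.
Require Import Defs.
From mathcomp Require Import all_boot all_order all_algebra.
From mathcomp Require Import all_classical all_reals all_analysis.
From mathcomp Require Import measurable_realfun unstable ring lra.

Set SsrOldRewriteGoalsOrder.
Set Implicit Arguments.
Unset Strict Implicit.
Unset Printing Implicit Defensive.

Import Order.TTheory GRing.Theory Num.Theory.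
Import numFieldNormedType.Exports.
Local Open Scope classical_set_scope.
Local Open Scope ring_scope.

(** Write g_i = 1/p_i^0 - 1/p_i^1 > 0.

    The net norm dominates the weak one: since the averages are nonincreasing in
    t, t1^(1/p1) t2^(1/p2) avg f t1 t2 is at most C ||f||. Applied to each term of
    a decomposition of f this gives
    t^(1/p) avg f t <= C s^(-theta) K(s) with s_i = t_i^(g_i), and the substitution
    t -> t^g only changes the norms with respect to dt/t by a constant.

    Conversely, fix t and let E_i average in the variable x_i over the cells of a
    grid of step t_i. Decompose f into the four products of E_i and 1 - E_i.
    Because E_i preserves integrals over unions of cells, the integral over I x J of
    each piece is a combination of at most 16 integrals of f over rectangles
    whose sides are longer than t_i (for E_i) or shorter (for 1 - E_i) and carry
    small enough coefficients. This gives
    t^(-g theta) K(t^g) <= C sum_(n, m) w1^|n| w2^|m| phi(2^n t1, 2^m t2), where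
    phi(t) = t^(1/p) avg f t and 0 <= w_i < 1; conclude by Minkowski's inequality
    and the invariance of dt/t under dilations. *)

(** * Integration with respect to dt/t *)

(** The rectangles of M are not aligned with the grid, so the cells cut by a side must be
    controlled. A side I contributes terms c times an integral over A with |c| |A| at most 2
    min(|I|, tau), where tau <= |A| is a dyadic multiple of the step t: tau >= t for the averaged
    part, tau <= t for the remainder. Dividing by |I| >= s leaves the factor min(1, tau / s), and
    s^(1/p^e) min(1, tau / s) has dt/t-norm of order tau^(1/p^e) for every q >= 1; it converges at
    infinity because p^e > 1. The index q enters only through the constant, which is why q_0 and q_1
    disappear from the result. The averaged part is measured with the exponent p_i^1 and the
    remainder with p_i^0. Comparing tau^(1/p^e) with tau^(1/p) gives the ratios w_i = 2^(-g (1 -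
    theta)) and 2^(-g theta), both below 1 because 0 < theta < 1. Averages and K-functionals may be
    infinite, and their measurability is drawn from monotonicity alone; Minkowski's inequality is
    therefore needed for measurable functions with values in [0, +oo]. *)

Section Density.
Local Open Scope ereal_scope.

(* The integral of a nonnegative function is a supremum over simple functions,
   hence monotone without any measurability assumption. *)
Lemma ge0_le_integral_lower d (T : measurableType d) (R : realType)
    (mu : {measure set T -> \bar R}) (D : set T) (f g : T -> \bar R) :
  (forall x, D x -> 0 <= f x) -> (forall x, D x -> f x <= g x) ->
  \int[mu]_(x in D) f x <= \int[mu]_(x in D) g x.
Proof.
move=> f0 fg; have g0 x : D x -> 0 <= g x.
  by move=> Dx; exact: le_trans (f0 _ Dx) (fg _ Dx).
rewrite !ge0_integralE//; apply: ereal_sup_le => _ [h /= hf <-].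
exists h => // x; apply: le_trans (hf x) _; rewrite /patch.
by case: ifPn => // /set_mem; exact: fg.
Qed.

Import HBNNSimple.

(** For indicators this is the hypothesis on [nu]; linearity gives simple functions and monotone
    convergence the rest. *)
Lemma ge0_integral_density d (T : measurableType d) (R : realType)
    (mu nu : {measure set T -> \bar R}) (w : T -> R) (f : T -> \bar R) :
  measurable_fun [set: T] w -> (forall x, (0 <= w x)%R) ->
  (forall A, measurable A -> nu A = \int[mu]_(x in A) (w x)%:E) ->
  measurable_fun [set: T] f -> (forall x, 0 <= f x) ->
  \int[nu]_x f x = \int[mu]_x (f x * (w x)%:E).
Proof.
move=> mw w0 nuE mf f0; have mw' : measurable_fun setT (EFin \o w) by exact/measurable_EFinP.
 pose h := nnsfun_approx measurableT mf.
have h0 n x : 0 <= (h n x)%:E by rewrite lee_fin.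
have mh n : measurable_fun setT (EFin \o h n).
  exact/measurable_EFinP/measurable_funP.
transitivity (limn (fun n => \int[nu]_x (h n x)%:E)).
  rewrite -monotone_convergence//; last first.
    by move=> x _ m n mn; rewrite lee_fin; exact/lefP/nd_nnsfun_approx.
  by apply: eq_integral => x _; apply/esym/cvg_lim => //;
    exact: cvg_nnsfun_approx.
transitivity (limn (fun n => \int[mu]_x ((h n x)%:E * (w x)%:E))); last first.
  rewrite -monotone_convergence//.
  - apply: eq_integral => x _; apply/cvg_lim => //.
    have hx : (h n x)%:E @[n --> \oo] --> f x by exact: cvg_nnsfun_approx.
    by apply: cvgeZr.
  - by move=> n; exact: emeasurable_funM (mh n) mw'.
  - by move=> n x _; rewrite mule_ge0// lee_fin.
  - move=> x _ m n mn; apply: lee_wpmul2r; first by rewrite lee_fin.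
    by rewrite lee_fin; exact/lefP/nd_nnsfun_approx.
congr (limn _); apply/funext => n.
under eq_integral do rewrite fimfunE -fsumEFin//.
rewrite ge0_integral_fsum//; last 2 first.
- by move=> r; exact/measurable_EFinP/measurable_funM.
- by move=> r x _; rewrite nnfun_muleindic_ge0.
under [RHS]eq_integral.
  move=> x _; rewrite fimfunE -fsumEFin// ge0_mule_fsuml; last first.
    by move=> r; rewrite nnfun_muleindic_ge0.
  over.
rewrite ge0_integral_fsum//; last 2 first.
- by move=> r; apply: emeasurable_funM => //; exact/measurable_EFinP/measurable_funM.
- by move=> r x _; apply: mule_ge0; [rewrite EFinM nnfun_muleindic_ge0|rewrite lee_fin].
apply: eq_fsbigr => r; rewrite inE => -[x _ <-].
rewrite integralZl_indic_nnsfun// integral_indic// setIT nuE//.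
under [RHS]eq_integral do rewrite EFinM -muleA.
rewrite ge0_integralZl//; last 3 first.
- apply: emeasurable_funM => //. exact/measurable_EFinP.
- by move=> y _; apply: mule_ge0; rewrite lee_fin.
- exact: h0.
congr (_ * _); rewrite integral_mkcond; apply: eq_integral => y _.
by rewrite patchE indicE; case: ifPn; rewrite ?mul1e ?mul0e.
Qed.
End Density.

Section ExponentialSubstitution.
Local Open Scope ereal_scope.

Lemma density_measure d (T : measurableType d) (R : realType)
    (mu : {measure set T -> \bar R}) (w : T -> R) :
  measurable_fun [set: T] w -> (forall x, (0 <= w x)%R) ->
  {nu : {measure set T -> \bar R} |
    forall A, measurable A -> nu A = \int[mu]_(x in A) (w x)%:E}.
Proof.
move=> mw w0; pose nu A := \int[mu]_(x in A) (w x)%:E.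
have nu0 : nu set0 = 0 by rewrite /nu integral_set0.
have nu_ge0 A : 0 <= nu A by apply: integral_ge0 => x _; rewrite lee_fin.
have nu_sadd : semi_sigma_additive nu.
  apply: semi_sigma_additive_nng_induced => [|x]; first exact/measurable_EFinP.
  by rewrite lee_fin.
pose nu_mixin := isMeasure.Build _ _ _ nu nu0 nu_ge0 nu_sadd.
pose nu_pack : {measure set T -> \bar R} := HB.pack nu nu_mixin.
by exists nu_pack.
Qed.

Lemma integral_invr_itv (R : realType) (a b : R) : (0 < a)%R -> (a < b)%R ->
  \int[@lebesgue_measure R]_(t in `[a, b]) t^-1%:E = (ln b - ln a)%:E.
Proof.
move=> a0 ab; rewrite EFinB; apply: continuous_FTC2 => //.
- apply: continuous_in_subspaceT => x /[!inE]/=; rewrite in_itv/= => /andP[ax _].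
  by apply: inv_continuous; rewrite gt_eqF// (lt_le_trans a0).
- split.
  + move=> x; rewrite in_itv/= => /andP[ax _].
    by apply: ex_derive; exact: is_derive1_ln (lt_trans a0 ax).
  + by apply: cvg_at_right_filter; exact: continuous_ln.
  + by apply: cvg_at_left_filter; apply: continuous_ln; exact: lt_trans ab.
- move=> x; rewrite in_itv/= => /andP[ax _].
  rewrite derive1E.
  by have /@derive_val -> := is_derive1_ln (lt_trans a0 ax).
Qed.

(** The measure with density 1/t on the half-line is carried by [ln] to Lebesgue measure, since both
    give b - a to an interval from a to b. This turns dt/t into a translation invariant measure on
    the whole line. *)
Lemma ge0_integral_expR (R : realType) (g : R -> \bar R) :
  measurable_fun (`]0%R, +oo[ : set R) g -> (forall t : R, (0 < t)%R -> 0 <= g t) ->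
  \int[@lebesgue_measure R]_(t in `]0%R, +oo[) (g t * t^-1%:E) =
  \int[@lebesgue_measure R]_u g (expR u).
Proof.
(* The density vanishes off the half-line, so the default value of [ln] there carries no mass. *)
move=> mg g0; pose w (t : R) : R := if (0 < t)%R then (t `^ (-1))%R else 0%R.
have pE : [set` `]0%R, +oo[] = [set t : R | (0 < t)%R].
  by apply/seteqP; split=> t /=; rewrite in_itv/= andbT.
have mw : measurable_fun [set: R] w.
  apply: measurable_fun_ifT => //.
  by apply: measurable_fun_ltr => //; exact: measurable_cst.
have w0 t : (0 <= w t)%R by rewrite /w; case: ifPn => // _; exact: powR_ge0.
have wE t : (0 < t)%R -> w t = t^-1%R.
  by move=> t0; rewrite /w t0 powR_inv1// ltW.
have [nu nuE] := @density_measure _ _ _ (@lebesgue_measure R) w mw w0.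
have mln : measurable_fun [set: measurableTypeR R] (@ln R : _ -> measurableTypeR R).
  exact: measurable_ln.
have lnnu (A : set (measurableTypeR R)) : measurable A ->
    lebesgue_measure A = pushforward nu (@ln R : measurableTypeR R -> measurableTypeR R) A.
  apply: lebesgue_measure_unique => _ [[a b]] _ <-; rewrite lebesgue_measure_itv/=.
  rewrite /pushforward nuE; last by rewrite -[X in measurable X]setTI; exact: mln.
  rewrite lte_fin; case: ifPn => ab; last first.
    by rewrite set_itv_ge ?preimage_set0 ?integral_set0// bnd_simp.
  (* The fundamental theorem of calculus is applied on the closed interval; the added endpoint is a
     null set. *)
  transitivity (\int[@lebesgue_measure R]_(t in `[expR a, expR b]) t^-1%:E).
    by rewrite integral_invr_itv ?expR_gt0 ?ltr_expR// !expRK.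
  rewrite -integral_itv_obnd_cbnd; last first.
    apply/measurable_EFinP; apply: (eq_measurable_fun w) => [t|].
      by rewrite inE/= in_itv/= => /andP[/(lt_trans (expR_gt0 _)) + _] => /wE.
    exact: measurable_funTS.
  rewrite [LHS]integral_mkcond [RHS]integral_mkcond.
  apply: eq_integral => t _; rewrite !patchE !mem_setE/= !in_itv/=.
  have [t0|t0] := ltP 0%R t; last first.
    rewrite ltNge (le_trans t0) ?expR_ge0//= /w ltNge t0/=.
    by case: ifP.
  by rewrite wE// -{1 2}(lnK t0) ltr_expR ler_expR.
have mg' : measurable_fun [set: R] (g \o expR).
  apply: (measurable_comp _ _ mg); first exact: measurable_itv.
    by move=> _ [u _ <-] /=; rewrite in_itv/= andbT expR_gt0.
  exact: measurable_expR.
have g0' u : 0 <= (g \o expR) u by apply: g0; exact: expR_gt0.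
transitivity (\int[nu]_t g (expR (ln t))).
  rewrite (@ge0_integral_density _ _ _ (@lebesgue_measure R) nu w)//; last first.
  - by move=> t; exact: g0'.
  - exact: measurableT_comp mg' mln.
  rewrite [LHS]integral_mkcond; apply: eq_integral => t _;
    rewrite patchE mem_setE/= in_itv/= andbT.
  case: ifPn => t0; last by rewrite /w (negbTE t0) mule0.
  by rewrite lnK// wE.
rewrite -[LHS](@ge0_integral_pushforward _ _ _ _ _ _ mln nu setT (g \o expR))//.
apply: eq_measure_integral => A mA _; exact/esym/lnnu.
Qed.
End ExponentialSubstitution.

(** * Minkowski's inequality for functions with values in [0, +oo] *)

Section PowerMean.
Local Open Scope ereal_scope.
Context d (T : measurableType d) (R : realType) (mu : {measure set T -> \bar R}).
Variable r : R.
Hypothesis r1 : (1 <= r)%R.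
Implicit Types h k : T -> \bar R.

Let r0 : (0 < r)%R. Proof. exact: lt_le_trans r1. Qed.

Lemma le_poweR (s : R) (x y : \bar R) : (0 <= s)%R -> 0 <= x -> x <= y ->
  poweR x s <= poweR y s.
Proof.
move=> s0 x0 xy; apply: gt0_ler_poweR => //; rewrite in_itv/= leey andbT//.
exact: le_trans xy.
Qed.

Lemma poweRK (s : R) (x : \bar R) : (0 < s)%R -> 0 <= x ->
  poweR (poweR x s) s^-1 = x.
Proof. by move=> s0 x0; rewrite -poweRrM mulfV ?gt_eqF// poweRe1. Qed.

Lemma poweRVK (s : R) (x : \bar R) : (0 < s)%R -> 0 <= x ->
  poweR (poweR x s^-1) s = x.
Proof. by move=> s0 x0; rewrite -poweRrM mulVf ?gt_eqF// poweRe1. Qed.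

Lemma ereal_nondecreasing_le_lim (u : nat -> \bar R) n :
  {homo u : m n / (m <= n)%N >-> m <= n} -> u n <= limn u.
Proof.
move=> ndu; rewrite (cvg_lim _ (ereal_nondecreasing_cvgn ndu))//.
by apply: ereal_sup_ubound; exists n.
Qed.

(** Meant for nonnegative functions that may take the value [+oo], hence no absolute value. *)
Definition Lr_norm h := poweR (\int[mu]_x poweR (h x) r) r^-1.

Lemma Lr_norm_ge0 h : 0 <= Lr_norm h. Proof. exact: poweR_ge0. Qed.

Lemma le_Lr_norm h k : (forall x, 0 <= h x) -> (forall x, h x <= k x) ->
  Lr_norm h <= Lr_norm k.
Proof.
move=> h0 hk; apply: le_poweR; first by rewrite invr_ge0 ltW.
  by apply: integral_ge0 => x _; exact: poweR_ge0.
apply: ge0_le_integral_lower => x _; first exact: poweR_ge0.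
by apply: le_poweR => //; exact: ltW.
Qed.

Lemma measurable_poweR_comp (s : R) h : measurable_fun [set: T] h ->
  measurable_fun [set: T] (fun x => poweR (h x) s).
Proof. exact: measurableT_comp (measurable_poweR s). Qed.

(** Monotone convergence in the form used twice: to pass from simple functions to functions with
    infinite values, and from finite sums to series. *)
Lemma Lr_norm_lim (h_ : nat -> T -> \bar R) h (B : \bar R) :
  (forall n, measurable_fun [set: T] (h_ n)) -> (forall n x, 0 <= h_ n x) ->
  (forall x, {homo (fun n => h_ n x) : m n / (m <= n)%N >-> m <= n}) ->
  (forall x, 0 <= h x) ->
  (forall x, h_ n x @[n --> \oo] --> h x) ->
  (forall n, Lr_norm (h_ n) <= B) -> Lr_norm h <= B.
Proof.
move=> mh h_0 ndh h0 hcvg hB.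
have B0 : 0 <= B by apply: le_trans (hB 0%N); exact: Lr_norm_ge0.
have ndp x : {homo (fun n => poweR (h_ n x) r) : m n / (m <= n)%N >-> m <= n}.
  by move=> m n mn; apply: le_poweR; [exact: ltW|exact: h_0|exact: ndh].
(* Only this half of the continuity of the power is needed. Taking r-th roots reduces it to a bound
   on each term of the increasing sequence. *)
have le_lim x : poweR (h x) r <= limn (fun n => poweR (h_ n x) r).
  have lim0 : 0 <= limn (fun n => poweR (h_ n x) r).
    apply: lime_ge; first exact: ereal_nondecreasing_is_cvgn.
    by apply: nearW => n; exact: poweR_ge0.
  rewrite -[leRHS](@poweRVK r)//; apply: le_poweR => //; first exact: ltW.
  rewrite -(cvg_lim _ (hcvg x))//; apply: lime_le.
    by apply/cvg_ex; exists (h x).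
  apply: nearW => n; rewrite -(@poweRK r (h_ n x))//.
  apply: le_poweR; [by rewrite invr_ge0 ltW|exact: poweR_ge0|].
  exact: ereal_nondecreasing_le_lim (ndp x).
rewrite -[leRHS](@poweRK r)//; apply: le_poweR; first by rewrite invr_ge0 ltW.
  by apply: integral_ge0 => x _; exact: poweR_ge0.
apply: (@le_trans _ _ (\int[mu]_x limn (fun n => poweR (h_ n x) r))).
  by apply: ge0_le_integral_lower => x _; [exact: poweR_ge0|exact: le_lim].
rewrite monotone_convergence//; last 2 first.
- by move=> n; exact: measurable_poweR_comp.
- by move=> n x _; exact: poweR_ge0.
apply: lime_le.
  apply: ereal_nondecreasing_is_cvgn => m n mn.
  by apply: ge0_le_integral_lower => x _; [exact: poweR_ge0|exact: ndp].
apply: nearW => n; rewrite -[leLHS](@poweRVK r)//; last first.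
  by apply: integral_ge0 => x _; exact: poweR_ge0.
by apply: le_poweR; [exact: ltW|exact: Lr_norm_ge0|exact: hB].
Qed.

Lemma Lr_norm_EFin (f : T -> R) : (forall x, (0 <= f x)%R) ->
  Lr_norm (EFin \o f) = Lnorm mu r%:E (EFin \o f).
Proof.
move=> f0; rewrite Lnorm.unlock /Lr_norm; apply: (congr1 (poweR ^~ _)).
by apply: eq_integral => x _; rewrite gee0_abs// lee_fin.
Qed.

Import HBNNSimple.

(** Minkowski's inequality for real-valued functions is applied to increasing simple approximations
    of both functions, and the bound survives in the limit. *)
Lemma Lr_normD h k : measurable_fun [set: T] h -> (forall x, 0 <= h x) ->
  measurable_fun [set: T] k -> (forall x, 0 <= k x) ->
  Lr_norm (h \+ k) <= Lr_norm h + Lr_norm k.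
Proof.
move=> mh h0 mk k0.
pose h_ := nnsfun_approx measurableT mh; pose k_ := nnsfun_approx measurableT mk.
have hcvg x : (h_ n x)%:E @[n --> \oo] --> h x by exact: cvg_nnsfun_approx.
have kcvg x : (k_ n x)%:E @[n --> \oo] --> k x by exact: cvg_nnsfun_approx.
have ndh x : {homo (fun n => h_ n x) : m n / (m <= n)%N >-> (m <= n)%R}.
  by move=> m n mn; exact/lefP/nd_nnsfun_approx.
have ndk x : {homo (fun n => k_ n x) : m n / (m <= n)%N >-> (m <= n)%R}.
  by move=> m n mn; exact/lefP/nd_nnsfun_approx.
have ub (u : nat -> R) l : {homo u : m n / (m <= n)%N >-> (m <= n)%R} ->
    (u n)%:E @[n --> \oo] --> l -> forall n, (u n)%:E <= l.
  move=> ndu ul n; rewrite -(cvg_lim _ ul)//.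
  by apply: (@ereal_nondecreasing_le_lim (EFin \o u)) => m p mp; rewrite lee_fin ndu.
apply: (@Lr_norm_lim (fun n x => (h_ n x + k_ n x)%:E)).
- move=> n; apply/measurable_EFinP/measurable_funD; exact/measurable_funP.
- by move=> n x; rewrite lee_fin addr_ge0.
- by move=> x m n mn; rewrite lee_fin; exact: lerD (ndh _ _ _ mn) (ndk _ _ _ mn).
- by move=> x; exact: adde_ge0.
- move=> x; under eq_fun do rewrite EFinD.
  by apply: cvgeD => //; rewrite ge0_adde_def// inE.
- move=> n; rewrite [leLHS](@Lr_norm_EFin (h_ n \+ k_ n)%R); last first.
    by move=> x; rewrite addr_ge0.
  apply: le_trans (minkowski_EFin _ _ _ _) _ => //.
  rewrite -!Lr_norm_EFin//.
  apply: leeD; apply: le_Lr_norm => x; rewrite ?lee_fin//=.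
  + by apply: (ub (fun n => h_ n x)).
  + by apply: (ub (fun n => k_ n x)).
Qed.

Lemma Lr_norm0 : Lr_norm (cst 0) = 0.
Proof.
rewrite /Lr_norm; under eq_integral do rewrite poweR0r ?gt_eqF//.
by rewrite integral0 poweR0r// invr_eq0 gt_eqF.
Qed.

Lemma Lr_norm_sum (I : Type) (s : seq I) (h_ : I -> T -> \bar R) :
  (forall i, measurable_fun [set: T] (h_ i)) -> (forall i x, 0 <= h_ i x) ->
  Lr_norm (fun x => \sum_(i <- s) h_ i x) <= \sum_(i <- s) Lr_norm (h_ i).
Proof.
move=> mh h0; elim: s => [|i s ih].
  under eq_fun do rewrite big_nil; rewrite big_nil.
  by rewrite (_ : (fun=> 0) = cst 0)// Lr_norm0.
under eq_fun do rewrite big_cons; rewrite big_cons.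
apply: le_trans (leeD2l _ ih); apply: Lr_normD => //.
- exact: emeasurable_sum.
- by move=> x; apply: sume_ge0 => j _.
Qed.

Lemma Lr_norm_nneseries (h_ : nat -> T -> \bar R) :
  (forall i, measurable_fun [set: T] (h_ i)) -> (forall i x, 0 <= h_ i x) ->
  Lr_norm (fun x => \sum_(i <oo) h_ i x) <= \sum_(i <oo) Lr_norm (h_ i).
Proof.
move=> mh h0.
apply: (@Lr_norm_lim (fun n x => \sum_(0 <= i < n) h_ i x)).
- by move=> n; exact: emeasurable_sum.
- by move=> n x; apply: sume_ge0 => j _.
- by move=> x m n mn; apply: lee_sum_nneg_natr => // j _ _; exact: h0.
- by move=> x; apply: nneseries_ge0 => j _ _; exact: h0.
- by move=> x; apply: is_cvg_nneseries => j _ _; exact: h0.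
- move=> n; apply: le_trans (Lr_norm_sum _ _ _) _ => //.
  by apply: nneseries_lim_ge => j _ _; exact: Lr_norm_ge0.
Qed.

End PowerMean.

(** * The norm with respect to dt/t: homogeneity, Minkowski, dilations *)

Section DttNorm.
Local Open Scope ereal_scope.
Context {R : realType}.
Implicit Types (q : \bar R) (phi psi : R -> \bar R).

(** With t = exp u, the map t -> lam t^g becomes the affine map u -> g u + ln lam. *)
Lemma ge0_integral_affine (g c : R) (h : R -> \bar R) : (0 < g)%R ->
  measurable_fun [set: R] h -> (forall u, 0 <= h u) ->
  \int[@lebesgue_measure R]_u h u =
  g%:E * \int[@lebesgue_measure R]_u h (g * u + c)%R.
Proof.
move=> g0 mh h0.
pose f (u : measurableTypeR R) : measurableTypeR R := (g * u + c)%R.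
have mf : measurable_fun [set: measurableTypeR R] f.
  by apply: measurable_funD => //; exact: measurable_funM.
transitivity (g%:E * \int[@lebesgue_measure R]_(u in f @^-1` setT) (h \o f) u); last first.
  by rewrite preimage_setT.
rewrite -(ge0_integral_pushforward mf)//.
rewrite -(@ge0_integral_mscale _ _ _ _ _ _ (NngNum (ltW g0)))//.
apply: eq_measure_integral => A mA _; apply: lebesgue_measure_unique mA => _ [[a b]] _ <-.
rewrite [RHS](_ : _ = g%:E * lebesgue_measure (f @^-1` `]a, b]%classic))//.
rewrite (_ : f @^-1` _ = [set` `](a - c) / g, (b - c) / g]%R]); last first.
  apply/seteqP; split => u /=; rewrite !in_itv/= /f ltr_pdivrMr// ler_pdivlMr//;
    by rewrite ltrBlDr lerBrDr mulrC.
rewrite !lebesgue_measure_itv/= !lte_fin ltr_pM2r ?invr_gt0// ltrD2r.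
case: ifPn => _; last by rewrite mule0.
by rewrite -!EFinB -EFinM -mulrBl mulrC divfK ?gt_eqF// opprB addrA subrK.
Qed.

Notation posR := ([set` `]0%R, +oo[] : set R).

Lemma mem_pos (t : R) : posR t = (0 < t)%R.
Proof. by rewrite /= in_itv/= andbT. Qed.

Lemma measurable_expR_comp phi : measurable_fun posR phi ->
  measurable_fun [set: R] (phi \o expR).
Proof.
move=> mphi; apply: (measurable_comp _ _ mphi); first exact: measurable_itv.
  by move=> _ [u _ <-] /=; rewrite in_itv/= andbT expR_gt0.
exact: measurable_expR.
Qed.

Lemma measurable_poweR_expR (r : R) phi : measurable_fun posR phi ->
  measurable_fun [set: R] (fun u => poweR (phi (expR u)) r).
Proof.
by move=> mphi; exact: measurableT_comp (measurable_poweR r) (measurable_expR_comp mphi).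
Qed.

Lemma dtt_norm_expR (r : R) phi : measurable_fun posR phi ->
  (forall t : R, (0 < t)%R -> 0 <= phi t) ->
  dtt_norm r%:E phi = Lr_norm (@lebesgue_measure R) r (phi \o expR).
Proof.
move=> mphi phi0; rewrite /dtt_norm /Lr_norm; congr poweR.
rewrite ge0_integral_expR//=; first exact: measurableT_comp (measurable_poweR r) mphi.
by move=> t _; exact: poweR_ge0.
Qed.

Lemma dtt_norm_ge0 q phi : (forall t : R, (0 < t)%R -> 0 <= phi t) ->
  0 <= dtt_norm q phi.
Proof.
move=> phi0; case: q => [r||] /=; [exact: poweR_ge0| |by []].
apply: le_trans (phi0 1%R ltr01) _; apply: ereal_sup_ubound.
by exists 1%R => //=; rewrite in_itv/= ltr01.
Qed.

Lemma le_dtt_norm q phi psi : 1 <= q ->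
  (forall t : R, (0 < t)%R -> 0 <= phi t) ->
  (forall t : R, (0 < t)%R -> phi t <= psi t) ->
  dtt_norm q phi <= dtt_norm q psi.
Proof.
move=> q1 phi0 phipsi; case: q q1 => [r|_|//] /=.
- rewrite lee_fin => r1; have r0 : (0 < r)%R by exact: lt_le_trans r1.
  apply: le_poweR; first by rewrite invr_ge0 ltW.
    apply: integral_ge0 => t; rewrite mem_pos => t0.
    by rewrite mule_ge0 ?poweR_ge0// lee_fin invr_ge0 ltW.
  apply: ge0_le_integral_lower => t; rewrite mem_pos => t0.
    by rewrite mule_ge0 ?poweR_ge0// lee_fin invr_ge0 ltW.
  apply: lee_wpmul2r; first by rewrite lee_fin invr_ge0 ltW.
  by apply: le_poweR; [exact: ltW|exact: phi0|exact: phipsi].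
- apply/ereal_supP => _ [t tpos <-]; have t0 : (0 < t)%R by rewrite -mem_pos.
  by apply: le_trans (phipsi _ t0) _; apply: ereal_sup_ubound; exists t.
Qed.

Lemma eq_dtt_norm q phi psi :
  (forall t : R, (0 < t)%R -> phi t = psi t) ->
  dtt_norm q phi = dtt_norm q psi.
Proof.
move=> e; case: q => [r||//] /=.
- congr poweR; apply: eq_integral => t; rewrite inE mem_pos => t0.
  by rewrite e.
- congr ereal_sup; apply: eq_imagel => t; rewrite mem_pos; exact: e.
Qed.

Lemma dtt_normZ q phi (c : R) : 1 <= q -> (0 <= c)%R -> measurable_fun posR phi ->
  (forall t : R, (0 < t)%R -> 0 <= phi t) ->
  dtt_norm q (fun t => c%:E * phi t) = c%:E * dtt_norm q phi.
Proof.
move=> q1 c0 mphi phi0; case: q q1 => [r|_|//].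
- rewrite lee_fin => r1; have r0 : (0 < r)%R by exact: lt_le_trans r1.
  have mp := @measurable_poweR_expR r _ mphi.
  rewrite !dtt_norm_expR//; last 2 first.
  + by apply: emeasurable_funM => //.
  + by move=> t t0; rewrite mule_ge0// ?lee_fin// phi0.
  rewrite /Lr_norm -[c%:E in RHS](@poweRK _ r)// -poweRM ?poweR_ge0//; last first.
    by apply: integral_ge0 => u _; exact: poweR_ge0.
  congr poweR; rewrite -ge0_integralZl//.
  + apply: eq_integral => u _ /=; rewrite poweRM// ?lee_fin//.
    by apply: phi0; exact: expR_gt0.
  + by move=> u _; exact: poweR_ge0.
  + exact: poweR_ge0.
- rewrite [dtt_norm _ phi](_ : _ = ereal_sup (phi @` posR))//.
  rewrite -[RHS]ereal_supZl//; last first.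
    by apply/set0P; exists (phi 1%R), 1%R => //=; rewrite in_itv/= ltr01.
  by rewrite /dtt_norm -image_comp.
Qed.

Lemma dtt_norm_sum q (I : Type) (s : seq I) (phi_ : I -> R -> \bar R) : 1 <= q ->
  (forall i, measurable_fun posR (phi_ i)) ->
  (forall i (t : R), (0 < t)%R -> 0 <= phi_ i t) ->
  dtt_norm q (fun t => \sum_(i <- s) phi_ i t) <= \sum_(i <- s) dtt_norm q (phi_ i).
Proof.
move=> q1 mphi phi0; case: q q1 => [r|_|//].
- rewrite lee_fin => r1; rewrite dtt_norm_expR//; last 2 first.
  + exact: emeasurable_sum.
  + by move=> t t0; apply: sume_ge0 => i _; exact: phi0.
  under eq_bigr => i _ do rewrite (dtt_norm_expR _ (mphi i) (phi0 i)).
  apply: (le_trans _ (@Lr_norm_sum _ _ _ (@lebesgue_measure R) r r1 I s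
    (fun i => phi_ i \o expR) _ _)) => // [i|i u].
    exact: measurable_expR_comp.
  by apply: phi0; exact: expR_gt0.
- apply/ereal_supP => _ [t tpos <-]; have t0 : (0 < t)%R by rewrite -mem_pos.
  by apply: lee_sum => i _; apply: ereal_sup_ubound; exists t.
Qed.

Lemma dtt_norm_nneseries q (phi_ : nat -> R -> \bar R) : 1 <= q ->
  (forall i, measurable_fun posR (phi_ i)) ->
  (forall i (t : R), (0 < t)%R -> 0 <= phi_ i t) ->
  dtt_norm q (fun t => \sum_(i <oo) phi_ i t) <= \sum_(i <oo) dtt_norm q (phi_ i).
Proof.
move=> q1 mphi phi0; case: q q1 => [r|_|//].
- rewrite lee_fin => r1; rewrite dtt_norm_expR//; last 2 first.
  + apply: ge0_emeasurable_sum => //.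
    by move=> i t; rewrite mem_pos => t0 _; exact: phi0.
  + by move=> t t0; apply: nneseries_ge0 => i _ _; exact: phi0.
  under eq_eseriesr => i _ do rewrite (dtt_norm_expR _ (mphi i) (phi0 i)).
  apply: (le_trans _ (@Lr_norm_nneseries _ _ _ (@lebesgue_measure R) r r1
    (fun i => phi_ i \o expR) _ _)) => // [i|i u].
    exact: measurable_expR_comp.
  by apply: phi0; exact: expR_gt0.
- apply/ereal_supP => _ [t tpos <-]; have t0 : (0 < t)%R by rewrite -mem_pos.
  apply: lee_nneseries => i _; first by move=> _; exact: phi0.
  by apply: ereal_sup_ubound; exists t.
Qed.

(** For finite q = r the Jacobian of u -> g u + ln lam gives c = g^(1/r). The constant is chosen
    before [phi] and [lam], so that two uses of the lemma can be cancelled against each other. *)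
Lemma dtt_norm_dilate q (g : R) : 1 <= q -> (0 < g)%R ->
  exists2 c : R, (0 < c)%R & forall phi (lam : R), (0 < lam)%R ->
    measurable_fun posR phi -> (forall t : R, (0 < t)%R -> 0 <= phi t) ->
    dtt_norm q phi = c%:E * dtt_norm q (fun t => phi (lam * t `^ g)%R).
Proof.
move=> q1 g0; case: q q1 => [r|_|//].
- rewrite lee_fin => r1; have r0 : (0 < r)%R by exact: lt_le_trans r1.
  exists (g `^ r^-1)%R; first exact: powR_gt0.
  move=> phi lam lam0 mphi phi0.
  rewrite !dtt_norm_expR//; last 2 first.
  + apply: (measurable_comp _ _ mphi); first exact: measurable_itv.
      move=> _ [u + <-]; rewrite !mem_pos => u0.
      by rewrite mulr_gt0// powR_gt0.
    apply: measurable_funM => //; apply: measurable_funTS; exact: measurable_powR.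
  + by move=> t t0; apply: phi0; rewrite mulr_gt0// powR_gt0.
  rewrite /Lr_norm -poweR_EFin -poweRM//; last 2 first.
  + by rewrite lee_fin ltW.
  + by apply: integral_ge0 => u _; exact: poweR_ge0.
  congr poweR; rewrite (@ge0_integral_affine g (ln lam))//.
  + congr (_ * _); apply: eq_integral => u _ /=.
    by rewrite expRD lnK// mulrC /powR gt_eqF ?expR_gt0// expRK.
  + exact: measurable_poweR_expR.
  + by move=> u; exact: poweR_ge0.
- exists 1%R => // phi lam lam0 _ _; rewrite mul1e /=.
  congr ereal_sup; apply/seteqP; split => _ [t tp <-]; have t0 : (0 < t)%R by rewrite -mem_pos.
    exists ((t / lam) `^ g^-1)%R; first by rewrite mem_pos powR_gt0// divr_gt0.
    rewrite -powRrM mulVf ?gt_eqF// powRr1 ?divr_ge0 ?ltW//.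
    by rewrite mulrC divfK// gt_eqF.
  exists (lam * t `^ g)%R => //; rewrite mem_pos mulr_gt0// powR_gt0//.
Qed.

End DttNorm.

(** * Mixed norms *)

Section MixedNorm.
Local Open Scope ereal_scope.
Context {R : realType}.
Notation posR := ([set` `]0%R, +oo[] : set R).
Implicit Types (q : \bar R) (phi : R -> \bar R) (psi : R -> R -> \bar R).

(** The superlevel sets in the half-line are intervals. *)
Lemma nonincreasing_emeasurable phi :
  (forall s t : R, (0 < s)%R -> (s <= t)%R -> phi t <= phi s) ->
  measurable_fun posR phi.
Proof.
move=> ni mD; apply: (measurability _ (ErealGenCInfty.measurableE R)) => //.
move=> _ [_ [r ->] <-].
apply: is_interval_measurable => s t/=; rewrite !in_itv/= !andbT.
move=> [s0 _] [t0 rt] u /andP[su ut].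
rewrite !in_itv/= !andbT (lt_le_trans s0 su); split => //.
by rewrite (le_trans rt)// ni// (lt_le_trans s0 su).
Qed.

Lemma nondecreasing_emeasurable phi :
  (forall s t : R, (0 < s)%R -> (s <= t)%R -> phi s <= phi t) ->
  measurable_fun posR phi.
Proof.
move=> nd mD; apply: (measurability _ (ErealGenCInfty.measurableE R)) => //.
move=> _ [_ [r ->] <-].
apply: is_interval_measurable => s t/=; rewrite !in_itv/= !andbT.
move=> [s0 rs] [t0 _] u /andP[su ut].
rewrite !in_itv/= !andbT (lt_le_trans s0 su); split => //.
by rewrite (le_trans rs)// nd.
Qed.

(* Satisfied by [net_avg f] and by the K-functional; monotonicity is what makes
   the functions under [dtt_norm], and their inner norms, measurable. *)
Definition monotone_pos psi :=
  (forall t2 s t : R, (0 < t2)%R -> (0 < s)%R -> (s <= t)%R ->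
     psi s t2 <= psi t t2 /\ psi t2 s <= psi t2 t) \/
  (forall t2 s t : R, (0 < t2)%R -> (0 < s)%R -> (s <= t)%R ->
     psi t t2 <= psi s t2 /\ psi t2 t <= psi t2 s).

Definition ge0_pos psi := forall t1 t2 : R, (0 < t1)%R -> (0 < t2)%R ->
  0 <= psi t1 t2.

(** The two measurability facts that Minkowski's inequality uses: one in [t1] for each fixed [t2],
    one for the inner norm as a function of [t2]. *)
Definition measurable_inner q psi :=
  (forall t2 : R, (0 < t2)%R -> measurable_fun posR (psi ^~ t2)) /\
  measurable_fun posR (fun t2 => dtt_norm q (psi ^~ t2)).

Lemma measurable_powR_pos (a : R) : measurable_fun posR (fun t : R => (t `^ a)%:E).
Proof. by apply/measurable_EFinP; apply: measurable_funTS; exact: measurable_powR. Qed.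

(** The power of [t2] leaves the inner norm by homogeneity. What remains is monotone in [t2],
    because the inner norm is monotone in its argument. *)
Lemma monotone_measurable_inner q psi (a b : R) : 1 <= q -> ge0_pos psi ->
  monotone_pos psi ->
  measurable_inner q (fun t1 t2 => (t1 `^ a * t2 `^ b)%:E * psi t1 t2).
Proof.
move=> q1 psi0 mpsi.
have m1 (t2 : R) : (0 < t2)%R -> measurable_fun posR (psi ^~ t2).
  move=> t20; case: mpsi => mpsi.
    by apply: nondecreasing_emeasurable => s t s0 st; have [] := mpsi t2 s t t20 s0 st.
  by apply: nonincreasing_emeasurable => s t s0 st; have [] := mpsi t2 s t t20 s0 st.
have m2 (t2 : R) : (0 < t2)%R -> measurable_fun posR (fun t1 => (t1 `^ a)%:E * psi t1 t2).
  by move=> t20; apply: emeasurable_funM; [exact: measurable_powR_pos|exact: m1].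
have n2 (t1 t2 : R) : (0 < t1)%R -> (0 < t2)%R -> 0 <= (t1 `^ a)%:E * psi t1 t2.
  by move=> t10 t20; rewrite mule_ge0 ?lee_fin ?powR_ge0// psi0.
have split_b (t1 t2 : R) : (t1 `^ a * t2 `^ b)%:E * psi t1 t2 =
    (t2 `^ b)%:E * ((t1 `^ a)%:E * psi t1 t2).
  by rewrite mulrC EFinM muleA.
split=> [t2 t20|].
  apply: (@eq_measurable_fun _ _ _ _ _
      (fun t1 => (t2 `^ b)%:E * ((t1 `^ a)%:E * psi t1 t2))) => [t1 _|].
    by rewrite split_b.
  by apply: emeasurable_funM => //; exact: m2.
apply: (@eq_measurable_fun _ _ _ _ _ (fun t2 => (t2 `^ b)%:E *
    dtt_norm q (fun t1 => (t1 `^ a)%:E * psi t1 t2))).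
  move=> t2; rewrite inE mem_pos => t20; rewrite -dtt_normZ ?powR_ge0//; last 2 first.
  - exact: m2.
  - by move=> t t0; exact: n2.
  by apply: eq_dtt_norm => t _; rewrite split_b.
apply: emeasurable_funM; first exact: measurable_powR_pos.
case: mpsi => mpsi.
  apply: nondecreasing_emeasurable => s t s0 st; apply: le_dtt_norm => // t1 t10.
    exact: n2.
  by apply: lee_wpmul2l; [rewrite lee_fin powR_ge0|have [] := mpsi t1 s t t10 s0 st].
apply: nonincreasing_emeasurable => s t s0 st; apply: le_dtt_norm => // t1 t10.
  by apply: n2 => //; exact: lt_le_trans st.
by apply: lee_wpmul2l; [rewrite lee_fin powR_ge0|have [] := mpsi t1 s t t10 s0 st].
Qed.

Variable q : \bar R * \bar R.
Hypotheses (q1 : 1 <= q.1) (q2 : 1 <= q.2).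

Lemma dtt_norm2_ge0 psi : ge0_pos psi -> 0 <= dtt_norm2 q psi.
Proof.
move=> psi0; apply: dtt_norm_ge0 => t2 t20; apply: dtt_norm_ge0 => t1 t10.
exact: psi0.
Qed.

Lemma le_dtt_norm2 psi1 psi2 : ge0_pos psi1 ->
  (forall t1 t2 : R, (0 < t1)%R -> (0 < t2)%R -> psi1 t1 t2 <= psi2 t1 t2) ->
  dtt_norm2 q psi1 <= dtt_norm2 q psi2.
Proof.
move=> psi0 le12; apply: le_dtt_norm => // t2 t20.
  by apply: dtt_norm_ge0 => t1 t10; exact: psi0.
by apply: le_dtt_norm => // t1 t10; [exact: psi0|exact: le12].
Qed.

Lemma dtt_norm2Z psi (c : R) : (0 <= c)%R -> ge0_pos psi ->
  measurable_inner q.1 psi ->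
  dtt_norm2 q (fun t1 t2 => c%:E * psi t1 t2) = c%:E * dtt_norm2 q psi.
Proof.
move=> c0 psi0 [m1 m2]; rewrite /dtt_norm2 -dtt_normZ//.
  by apply: eq_dtt_norm => t2 t20; rewrite dtt_normZ//; [exact: m1|move=> t1 t10; exact: psi0].
by move=> t2 t20; apply: dtt_norm_ge0 => t1 t10; exact: psi0.
Qed.

Lemma dtt_norm2_dilate (g1 g2 : R) : (0 < g1)%R -> (0 < g2)%R ->
  exists2 c : R, (0 < c)%R & forall psi (lam1 lam2 : R),
    (0 < lam1)%R -> (0 < lam2)%R -> ge0_pos psi -> measurable_inner q.1 psi ->
    dtt_norm2 q psi = c%:E *
      dtt_norm2 q (fun t1 t2 => psi (lam1 * t1 `^ g1)%R (lam2 * t2 `^ g2)%R).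
Proof.
move=> g10 g20; have [c1 c10 H1] := dtt_norm_dilate q1 g10.
have [c2 c20 H2] := dtt_norm_dilate q2 g20.
exists (c1 * c2)%R; first exact: mulr_gt0.
move=> psi lam1 lam2 lam10 lam20 psi0 [m1 m2].
have pos2 (t2 : R) : (0 < t2)%R -> (0 < lam2 * t2 `^ g2)%R.
  by move=> t20; rewrite mulr_gt0// powR_gt0.
have inner (t2 : R) : (0 < t2)%R ->
    dtt_norm q.1 (psi ^~ t2) = c1%:E * dtt_norm q.1 (fun t1 => psi (lam1 * t1 `^ g1)%R t2).
  by move=> t20; rewrite (H1 _ lam1)//; [exact: m1|move=> t t0; exact: psi0].
rewrite /dtt_norm2 (H2 _ lam2)//; last first.
  by move=> t2 t20; apply: dtt_norm_ge0 => t1 t10; exact: psi0.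
rewrite (@eq_dtt_norm _ _ _ (fun t2 => c1%:E *
  dtt_norm q.1 (fun t1 => psi (lam1 * t1 `^ g1)%R (lam2 * t2 `^ g2)%R))); last first.
  by move=> t2 t20; rewrite inner// pos2.
rewrite dtt_normZ ?muleA -?EFinM 1?mulrC//; first exact: ltW.
- apply: (@eq_measurable_fun _ _ _ _ _ (fun t2 => c1^-1%:E *
    dtt_norm q.1 (psi ^~ (lam2 * t2 `^ g2)%R))).
    move=> t2; rewrite inE mem_pos => t20.
    by rewrite inner ?pos2// muleA -EFinM mulVf ?mul1e// gt_eqF.
  apply: emeasurable_funM => //.
  apply: (measurable_comp _ _ m2); first exact: measurable_itv.
    by move=> _ [u + <-]; rewrite !mem_pos; exact: pos2.
  apply: measurable_funM => //; apply: measurable_funTS; exact: measurable_powR.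
- move=> t2 t20; apply: dtt_norm_ge0 => t1 t10; apply: psi0; last exact: pos2.
  by rewrite mulr_gt0// powR_gt0.
Qed.

Lemma dtt_norm_sum_nneseries2 (r : \bar R) (I : Type) (s : seq I)
    (f : I -> nat -> nat -> R -> \bar R) :
  1 <= r ->
  (forall e n m, measurable_fun posR (f e n m)) ->
  (forall e n m (t : R), (0 < t)%R -> 0 <= f e n m t) ->
  dtt_norm r (fun t => \sum_(e <- s) \sum_(n <oo) \sum_(m <oo) f e n m t) <=
  \sum_(e <- s) \sum_(n <oo) \sum_(m <oo) dtt_norm r (f e n m).
Proof.
move=> r1 mf f0.
have f0' e n (t : R) : (0 < t)%R -> 0 <= \sum_(m <oo) f e n m t.
  by move=> t0; apply: nneseries_ge0 => m _ _; exact: f0.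
have mf' e n : measurable_fun posR (fun t => \sum_(m <oo) f e n m t).
  by apply: ge0_emeasurable_sum => // m t; rewrite mem_pos => t0 _; exact: f0.
apply: le_trans (dtt_norm_sum _ _ _ _) _ => //.
- move=> e; apply: ge0_emeasurable_sum => // m t; rewrite mem_pos => t0 _; exact: f0'.
- by move=> e t t0; apply: nneseries_ge0 => n _ _; exact: f0'.
apply: lee_sum => e _; apply: le_trans (dtt_norm_nneseries _ _ _) _ => //.
- by move=> n t t0; exact: f0'.
apply: lee_nneseries => [n _ _|n _].
  by apply: dtt_norm_ge0 => t t0; exact: f0'.
by apply: dtt_norm_nneseries => // m t t0; exact: f0.
Qed.

Lemma dtt_norm2_sum_nneseries2 (I : Type) (s : seq I)
    (f : I -> nat -> nat -> R -> R -> \bar R) :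
  (forall e n m, measurable_inner q.1 (f e n m)) ->
  (forall e n m, ge0_pos (f e n m)) ->
  dtt_norm2 q (fun t1 t2 => \sum_(e <- s) \sum_(n <oo) \sum_(m <oo) f e n m t1 t2) <=
  \sum_(e <- s) \sum_(n <oo) \sum_(m <oo) dtt_norm2 q (f e n m).
Proof.
move=> mf f0; apply: le_trans (dtt_norm_sum_nneseries2 _ _ _ _) => //; last 2 first.
- by move=> e n m; case: (mf e n m).
- by move=> e n m t2 t20; apply: dtt_norm_ge0 => t1 t10; exact: f0.
apply: le_dtt_norm => // t2 t20.
  apply: dtt_norm_ge0 => t1 t10; apply: sume_ge0 => e _.
  by apply: nneseries_ge0 => n _ _; apply: nneseries_ge0 => m _ _; exact: f0.
apply: dtt_norm_sum_nneseries2 => // [e n m|e n m t t0]; last exact: f0.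
by case: (mf e n m) => + _; exact.
Qed.

End MixedNorm.

(** * Pointwise bounds, and the model functions s^a min(1, t/s) *)

Section NormEstimates.
Local Open Scope ereal_scope.
Context {R : realType}.
Notation posR := ([set` `]0%R, +oo[] : set R).

Definition nonincreasing_pos (phi : R -> \bar R) :=
  forall s t : R, (0 < s)%R -> (s <= t)%R -> phi t <= phi s.

(** For s in [t/2, t] one has phi s >= phi t, s^a >= (t/2)^a and 1/s >= 1/t, so this interval has
    dt/t-mass at least 1/2. Hence the constant 2^a 2^(1/r) for finite q = r. *)
Lemma nonincreasing_le_dtt_norm (q : \bar R) (a : R) : 1 <= q -> (0 <= a)%R ->
  exists2 C : R, (0 < C)%R & forall phi, nonincreasing_pos phi ->
    (forall t : R, (0 < t)%R -> 0 <= phi t) -> forall t : R, (0 < t)%R ->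
    (t `^ a)%:E * phi t <= C%:E * dtt_norm q (fun s => (s `^ a)%:E * phi s).
Proof.
move=> q1 a0; case: q q1 => [r|_|//]; last first.
  exists 1%R => // phi _ _ t t0; rewrite mul1e /=.
  by apply: ereal_sup_ubound; exists t => //; rewrite mem_pos.
rewrite lee_fin => r1; have r0 : (0 < r)%R by exact: lt_le_trans r1.
exists (2 `^ a * 2 `^ r^-1)%R; first by rewrite mulr_gt0// powR_gt0.
move=> phi ni phi0 t t0.
pose X := ((t / 2) `^ a)%:E * phi t.
have X0 : 0 <= X by rewrite mule_ge0 ?lee_fin ?powR_ge0// phi0.
have -> : (t `^ a)%:E * phi t = (2 `^ a)%:E * X.
  rewrite /X muleA -EFinM -powRM//; last by rewrite divr_ge0 ?ltW.
  by rewrite mulrC divfK.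
rewrite EFinM -muleA; apply: lee_wpmul2l; first by rewrite lee_fin powR_ge0.
have -> : X = (2 `^ r^-1)%:E * poweR (poweR X r * 2^-1%:E) r^-1.
  rewrite poweRM ?poweR_ge0 ?lee_fin// poweRK// muleCA -poweR_EFin -poweRM ?lee_fin//.
  by rewrite -EFinM mulfV// poweR1r mule1.
apply: lee_wpmul2l; first by rewrite lee_fin powR_ge0.
rewrite /dtt_norm; apply: le_poweR; first by rewrite invr_ge0 ltW.
  by rewrite mule_ge0 ?poweR_ge0// lee_fin.
have t20 : (0 < t / 2)%R by rewrite divr_gt0.
have t2t : (t / 2 < t)%R by rewrite gtr_pMr// invf_lt1// ltr1n.
pose K : \bar R := poweR X r * (t^-1)%:E.
pose h : R -> \bar R := (cst K) \_ (`[(t / 2)%R, t]%classic : set R).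
apply: (@le_trans _ _ (\int[@lebesgue_measure R]_(s in `]0%R, +oo[) h s)).
  rewrite -integral_mkcondr.
  rewrite (_ : _ `&` _ = `[(t / 2)%R, t]%classic); last first.
    by apply: setIidr => s /=; rewrite !in_itv/= andbT => /andP[+ _]; exact: lt_le_trans.
  rewrite integral_cst//= lebesgue_measure_itv/= lte_fin t2t -EFinB.
  rewrite -muleA -EFinM lee_wpmul2l ?poweR_ge0// lee_fin.
  by rewrite mulrBr mulVf ?gt_eqF// mulrA mulVf ?gt_eqF//; lra.
apply: ge0_le_integral_lower => s; rewrite mem_pos => s0.
  rewrite /h patchE; case: ifPn => // _.
  by rewrite mule_ge0 ?poweR_ge0// lee_fin invr_ge0 ltW.
rewrite /h patchE; case: ifPn; last first.
  by move=> _; rewrite mule_ge0 ?poweR_ge0// lee_fin invr_ge0 ltW.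
rewrite inE/= in_itv/= => /andP[ts st].
apply: lee_pmul; first exact: poweR_ge0.
- by rewrite lee_fin invr_ge0 ltW.
- apply: le_poweR => //; first exact: ltW.
  apply: lee_pmul; [by rewrite lee_fin powR_ge0|exact: phi0| |exact: ni].
  by rewrite lee_fin; apply: ge0_ler_powR => //; rewrite nnegrE ltW.
- by rewrite lee_fin lef_pV2.
Qed.

(** The one-variable bound is used in [t2] with [t1] frozen, then in [t1] under the outer norm. *)
Lemma nonincreasing_le_dtt_norm2 (q : \bar R * \bar R) (a b : R) :
  1 <= q.1 -> 1 <= q.2 -> (0 <= a)%R -> (0 <= b)%R ->
  exists2 C : R, (0 < C)%R & forall psi, ge0_pos psi ->
    (forall t2, (0 < t2)%R -> nonincreasing_pos (psi ^~ t2)) ->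
    (forall t1, (0 < t1)%R -> nonincreasing_pos (psi t1)) ->
    forall t1 t2 : R, (0 < t1)%R -> (0 < t2)%R ->
    (t1 `^ a * t2 `^ b)%:E * psi t1 t2 <=
      C%:E * dtt_norm2 q (fun s1 s2 => (s1 `^ a * s2 `^ b)%:E * psi s1 s2).
Proof.
move=> q1 q2 a0 b0.
have [C1 C10 H1] := nonincreasing_le_dtt_norm q1 a0.
have [C2 C20 H2] := nonincreasing_le_dtt_norm q2 b0.
exists (C2 * C1)%R; first exact: mulr_gt0.
move=> psi psi0 ni1 ni2 t1 t2 t10 t20.
have mpsi : monotone_pos psi by right => u s t u0 s0 st; split; [exact: ni1|exact: ni2].
have [_ m2] := @monotone_measurable_inner R q.1 psi a b q1 psi0 mpsi.
have swap (x y : R) z : (x * y)%:E * z = y%:E * (x%:E * z).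
  by rewrite mulrC EFinM muleA.
rewrite swap.
apply: le_trans (H2 (fun s2 => (t1 `^ a)%:E * psi t1 s2) _ _ t2 t20) _.
- move=> s t s0 st; apply: lee_wpmul2l; first by rewrite lee_fin powR_ge0.
  exact: ni2.
- by move=> t t0; rewrite mule_ge0 ?lee_fin ?powR_ge0// psi0.
rewrite EFinM -muleA; apply: lee_wpmul2l; first by rewrite lee_fin ltW.
rewrite /dtt_norm2 -dtt_normZ//; last 2 first.
- exact: ltW.
- move=> s2 s20; apply: dtt_norm_ge0 => s1 s10.
  by rewrite mule_ge0 ?lee_fin ?mulr_ge0 ?powR_ge0// psi0.
apply: le_dtt_norm => // s2 s20.
  by rewrite !mule_ge0 ?lee_fin ?powR_ge0// psi0.
rewrite muleCA.
rewrite (@eq_dtt_norm _ _ _ (fun s1 => (s1 `^ a)%:E * ((s2 `^ b)%:E * psi s1 s2))); last first.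
  by move=> s1 s10; rewrite muleA -EFinM.
apply: (H1 (fun s1 => (s2 `^ b)%:E * psi s1 s2)) => //.
- move=> s t s0 st; apply: lee_wpmul2l; first by rewrite lee_fin powR_ge0.
  exact: ni1.
- by move=> t t0; rewrite mule_ge0 ?lee_fin ?powR_ge0// psi0.
Qed.

(** By symmetry this is twice a half-line integral, which the density of the exponential law
    evaluates. *)
Lemma integral_expR_norm (k : R) : (0 < k)%R ->
  \int[@lebesgue_measure R]_u (expR (- (k * `|u|)))%:E < +oo.
Proof.
move=> k0; rewrite ge0_symfun_integralT; last 3 first.
- by move=> u; exact: expR_ge0.
- move=> u; apply: continuous_comp; last exact: continuous_expR.
  by apply: continuousN; apply: continuousM; [exact: cst_continuous|exact: norm_continuous].
- by move=> u /=; rewrite normrN.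
rewrite lte_mul_pinfty ?lee_fin//.
apply: (@le_lt_trans _ _ (\int[@lebesgue_measure R]_u (k^-1%:E * (exponential_pdf k u)%:E))).
  rewrite integral_mkcond; apply: ge0_le_integral_lower => u _; rewrite patchE.
    by case: ifPn => // _; rewrite lee_fin expR_ge0.
  case: ifPn => [|_].
    rewrite inE/= => u0; rewrite exponential_pdfE// ger0_norm// -EFinM mulrA mulVf ?gt_eqF//.
    by rewrite mul1r mulNr.
  by rewrite -EFinM lee_fin mulr_ge0// ?invr_ge0 ?exponential_pdf_ge0 ?ltW.
rewrite ge0_integralZl//; last 3 first.
- by apply/measurable_EFinP; exact: measurable_exponential_pdf.
- by move=> u _; rewrite lee_fin exponential_pdf_ge0 ?ltW.
- by rewrite lee_fin invr_ge0 ltW.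
by rewrite integral_exponential_pdf// mule1 ltry.
Qed.

Lemma measurable_powR_min (a t : R) :
  measurable_fun posR (fun s => s `^ a * Num.min 1 (t / s))%R.
Proof.
apply: measurable_funM; first by apply: measurable_funTS; exact: measurable_powR.
apply: measurable_minr; first exact: measurable_cst.
apply: measurable_funM; first exact: measurable_cst.
apply: (@eq_measurable_fun _ _ _ _ _ (fun s : R => s `^ (-1))%R).
  by move=> s; rewrite inE mem_pos => s0; rewrite powR_inv1// ltW.
by apply: measurable_funTS; exact: measurable_powR.
Qed.

Lemma powR_min_ge0 (a t s : R) : (0 < t)%R -> (0 < s)%R ->
  (0 <= s `^ a * Num.min 1 (t / s))%R.
Proof.
move=> t0 s0; rewrite mulr_ge0 ?powR_ge0// le_min ler01/=.
by rewrite divr_ge0// ltW.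
Qed.

(** A dilation by t reduces to t = 1 and produces the factor t^a. With s = exp u the function at t =
    1 is at most exp(-k |u|) for k = min(a, 1 - a), which is positive exactly when 0 < a < 1; later
    a = 1/p with p > 1. *)
Lemma dtt_norm_powR_min (q : \bar R) (a : R) : 1 <= q -> (0 < a < 1)%R ->
  exists2 C : R, (0 < C)%R & forall t : R, (0 < t)%R ->
    dtt_norm q (fun s => (s `^ a * Num.min 1 (t / s))%:E) <= (C * t `^ a)%:E.
Proof.
move=> q1 /andP[a0 a1].
pose phi (s : R) := (s `^ a * Num.min 1 (1 / s))%:E.
have phi0 (s : R) : (0 < s)%R -> 0 <= phi s by move=> s0; rewrite lee_fin powR_min_ge0.
have mphi : measurable_fun posR phi by apply/measurable_EFinP; exact: measurable_powR_min.
have fin : dtt_norm q phi < +oo.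
  pose k : R := Num.min a (1 - a)%R.
  have k0 : (0 < k)%R by rewrite lt_min a0 subr_gt0.
  have ka : (k <= a)%R by rewrite ge_min lexx.
  have k1a : (k <= 1 - a)%R by rewrite ge_min lexx orbT.
  have expRa (x y : R) : (expR x `^ y = expR (y * x))%R.
    by rewrite /powR gt_eqF ?expR_gt0// expRK.
  have bnd (u : R) : (phi (expR u) <= (expR (- (k * `|u|)))%:E).
    rewrite lee_fin expRa; have [u0|u0] := leP 0%R u.
      apply: (@le_trans _ _ (expR (a * u) * expR (- u))%R).
        rewrite ler_pM2l ?expR_gt0// ge_min; apply/orP; right.
        by rewrite expRN div1r.
      by rewrite -expRD ler_expR ger0_norm//; nra.
    apply: (@le_trans _ _ (expR (a * u) * 1)%R).
      by rewrite ler_pM2l ?expR_gt0// ge_min lexx.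
    by rewrite mulr1 ler_expR ltr0_norm//; nra.
  case: q q1 => [r|_|//].
    rewrite lee_fin => r1; have r0 : (0 < r)%R by exact: lt_le_trans r1.
    rewrite dtt_norm_expR//; apply: poweR_lty.
    apply: le_lt_trans (integral_expR_norm (mulr_gt0 r0 k0)).
    apply: ge0_le_integral_lower => u _; first exact: poweR_ge0.
    apply: le_trans (le_poweR (ltW r0) _ (bnd u)) _.
      by apply: phi0; exact: expR_gt0.
    by rewrite poweR_EFin expRa mulrN mulrA.
  apply: (@le_lt_trans _ _ 1); last exact: ltry.
  apply/ereal_supP => _ [t tp <-]; have t0 : (0 < t)%R by rewrite -mem_pos.
  rewrite -(lnK t0); apply: le_trans (bnd _) _.
  by rewrite lee_fin -expR0 ler_expR oppr_le0 mulr_ge0// ltW.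
have [c c0 Hc] := dtt_norm_dilate q1 (@ltr01 R).
have N0 : 0 <= dtt_norm q phi by exact: dtt_norm_ge0.
(* The added 1 only makes the constant visibly positive. *)
exists (c * fine (dtt_norm q phi) + 1)%R.
  by rewrite ltr_wpDl//; apply: mulr_ge0; [exact: ltW|exact: fine_ge0].
move=> t t0; rewrite (Hc _ t)//; last 2 first.
- by apply/measurable_EFinP; exact: measurable_powR_min.
- by move=> s s0; rewrite lee_fin powR_min_ge0.
rewrite (@eq_dtt_norm _ _ _ (fun s => (t `^ a)%:E * phi s)); last first.
  move=> s s0; rewrite powRr1 ?ltW// -EFinM powRM ?ltW// mulrA.
  by congr (_ * Num.min _ _)%:E; rewrite invfM mulrA divff ?gt_eqF.
have Nfin : dtt_norm q phi \is a fin_num by rewrite ge0_fin_numE.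
rewrite dtt_normZ ?powR_ge0// -(fineK Nfin).
by rewrite -!EFinM lee_fin mulrCA mulrC ler_wpM2r ?powR_ge0// lerDl ler01.
Qed.

Lemma dtt_norm2_tensor (q : \bar R * \bar R) (u v : R -> R) (A B : R) :
  1 <= q.1 -> 1 <= q.2 -> measurable_fun posR u -> measurable_fun posR v ->
  (forall t : R, (0 < t)%R -> (0 <= u t)%R) -> (forall t : R, (0 < t)%R -> (0 <= v t)%R) ->
  dtt_norm q.1 (EFin \o u) <= A%:E -> dtt_norm q.2 (EFin \o v) <= B%:E ->
  measurable_inner q.1 (fun s1 s2 => (u s1 * v s2)%:E) /\
  dtt_norm2 q (fun s1 s2 => (u s1 * v s2)%:E) <= (A * B)%:E.
Proof.
move=> q1 q2 mu mv u0 v0 uA vB.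
have mu' : measurable_fun posR (EFin \o u) by exact/measurable_EFinP.
have mv' : measurable_fun posR (EFin \o v) by exact/measurable_EFinP.
have A0 : (0 <= A)%R.
  by rewrite -lee_fin; apply: le_trans uA; apply: dtt_norm_ge0 => t t0; rewrite lee_fin u0.
have inner (s2 : R) : (0 < s2)%R ->
    dtt_norm q.1 (fun s1 => (u s1 * v s2)%:E) = (v s2)%:E * dtt_norm q.1 (EFin \o u).
  move=> s20; rewrite -dtt_normZ ?v0//.
  by apply: eq_dtt_norm => t t0 /=; rewrite -EFinM mulrC.
split.
  split=> [s2 s20|].
    apply/measurable_EFinP; apply: measurable_funM => //.
  apply: (@eq_measurable_fun _ _ _ _ _ (fun s2 => (v s2)%:E * dtt_norm q.1 (EFin \o u))).
    by move=> s2; rewrite inE mem_pos => s20; rewrite inner.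
  exact: emeasurable_funM.
apply: (@le_trans _ _ (dtt_norm q.2 (fun s2 => A%:E * (EFin \o v) s2))).
  apply: le_dtt_norm => // s2 s20.
    by apply: dtt_norm_ge0 => s1 s10; rewrite lee_fin mulr_ge0 ?u0 ?v0.
  by rewrite inner// muleC; apply: lee_wpmul2r => //; rewrite lee_fin v0.
rewrite dtt_normZ//.
by rewrite EFinM; apply: lee_wpmul2l; rewrite ?lee_fin.
Qed.

Lemma nneseries_geometric (x : R) : (0 <= x < 1)%R ->
  \sum_(n <oo) (x ^+ n)%:E = ((1 - x)^-1)%:E.
Proof.
move=> /andP[x0 x1].
have x1' : (`|x| < 1)%R by rewrite ger0_norm.
apply/cvg_lim => //.
rewrite (_ : (fun n => _) = EFin \o series (geometric 1 x)); last first.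
  apply/funext => n /=; rewrite /series/= -sumEFin.
  by apply: eq_bigr => i _; rewrite /= mul1r.
apply/fine_cvgP; split; first exact: nearW.
rewrite (_ : fine \o _ = series (geometric 1 x))//.
by have := @cvg_geometric_series R 1 x x1'; rewrite mul1r.
Qed.

End NormEstimates.

(** * Averages and the K-functional *)

Section NetAvg.
Local Open Scope ereal_scope.
Context {R : realType}.
Implicit Types (f g : {mfun plane R >-> R}) (Q : segment R * segment R).

Lemma seg_length_gt0 (I : segment R) : (0 < seg_length I)%R.
Proof. by rewrite subr_gt0; exact: seg_lt. Qed.

Lemma measurable_rect_set Q : measurable (rect_set Q).
Proof. by apply: measurableX; exact: measurable_itv. Qed.

Lemma net_avg_ub f Q (t1 t2 : R) : (t1 <= seg_length Q.1)%R ->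
  (t2 <= seg_length Q.2)%R ->
  (seg_length Q.1 * seg_length Q.2)^-1%:E *
    `| \int[lebesgue2 R]_(x in rect_set Q) (f x)%:E | <= net_avg f t1 t2.
Proof. by move=> Q1 Q2; apply: ereal_sup_ubound; exists Q. Qed.

Lemma net_avg_lub f (t1 t2 : R) (B : \bar R) :
  (forall Q, (t1 <= seg_length Q.1)%R -> (t2 <= seg_length Q.2)%R ->
    (seg_length Q.1 * seg_length Q.2)^-1%:E *
      `| \int[lebesgue2 R]_(x in rect_set Q) (f x)%:E | <= B) ->
  net_avg f t1 t2 <= B.
Proof. by move=> H; apply/ereal_supP => _ [Q [Q1 Q2] <-]; exact: H. Qed.

Lemma rect_avg_ge0 f Q : 0 <= (seg_length Q.1 * seg_length Q.2)^-1%:E *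
    `| \int[lebesgue2 R]_(x in rect_set Q) (f x)%:E |.
Proof. by rewrite mule_ge0// lee_fin invr_ge0 mulr_ge0// ltW// seg_length_gt0. Qed.

Lemma net_avg_ge0 f (t1 t2 : R) : 0 <= net_avg f t1 t2.
Proof.
have lt0 (t : R) : (0 < Num.max t 1)%R by rewrite lt_max ltr01 orbT.
pose Q := (Segment (lt0 t1), Segment (lt0 t2)).
apply: le_trans (rect_avg_ge0 f Q) _.
by apply: net_avg_ub; rewrite /seg_length/= subr0 le_max lexx.
Qed.

Lemma net_avg_nonincreasing f (s1 s2 t1 t2 : R) : (s1 <= t1)%R -> (s2 <= t2)%R ->
  net_avg f t1 t2 <= net_avg f s1 s2.
Proof.
move=> s1t1 s2t2; apply: net_avg_lub => Q Q1 Q2.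
by apply: net_avg_ub; [exact: le_trans Q1|exact: le_trans Q2].
Qed.

Lemma measurable_EFin_mfun f (D : set (plane R)) : measurable_fun D (EFin \o f).
Proof. by apply: measurable_funTS; apply/measurable_EFinP. Qed.

(** Decompositions hold only almost everywhere, which integrals over rectangles do not see. The
    first conclusion also supplies the integrability demanded of elements of [net_space]. *)
Lemma integrable_on_rects_ae (I : finType) (a : {mfun plane R >-> R})
    (b : I -> {mfun plane R >-> R}) :
  (forall e, integrable_on_rects (b e)) ->
  {ae lebesgue2 R, forall x, a x = (\sum_(e : I) b e x)%R} ->
  integrable_on_rects a /\
  forall Q, \int[lebesgue2 R]_(x in rect_set Q) (a x)%:E =
    \sum_(e : I) \int[lebesgue2 R]_(x in rect_set Q) (b e x)%:E.
Proof.
move=> ib ab.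
have isum Q : (lebesgue2 R).-integrable (rect_set Q)
    (fun x => \sum_(e : I) (b e x)%:E).
  apply: integrable_sum; first exact: measurable_rect_set.
  by move=> e _; exact: ib.
have ae Q : ae_eq (lebesgue2 R) (rect_set Q) (EFin \o a)
    (fun x => \sum_(e : I) (b e x)%:E).
  by apply: filterS ab => x abx _ /=; rewrite abx sumEFin.
split=> [Q|Q].
  apply/integrableP; split; first exact: measurable_EFin_mfun.
  have [ms fs] := integrableP _ _ _ (isum Q).
  apply: le_lt_trans fs.
  rewrite le_eqVlt; apply/orP; left; apply/eqP.
  apply: ge0_ae_eq_integral => //.
  - exact: measurable_rect_set.
  - by apply: measurableT_comp => //; exact: measurable_EFin_mfun.
  - exact: measurableT_comp.
  - by apply: filterS (ae Q) => x + Qx => /(_ Qx) ->.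
rewrite (ae_eq_integral (fun x => \sum_(e : I) (b e x)%:E))//.
- rewrite integral_sum//; first exact: measurable_rect_set.
  by move=> e; exact: ib.
- exact: measurable_rect_set.
- exact: measurable_EFin_mfun.
- by have [] := integrableP _ _ _ (isum Q).
Qed.

Lemma net_avg_sum (I : finType) (a : {mfun plane R >-> R})
    (b : I -> {mfun plane R >-> R}) (t1 t2 : R) :
  (forall e, integrable_on_rects (b e)) ->
  {ae lebesgue2 R, forall x, a x = (\sum_(e : I) b e x)%R} ->
  net_avg a t1 t2 <= \sum_(e : I) net_avg (b e) t1 t2.
Proof.
move=> ib ab; apply: net_avg_lub => Q Q1 Q2.
have [_ ->] := integrable_on_rects_ae ib ab.
have Q0 : 0 <= (seg_length Q.1 * seg_length Q.2)^-1%:E :> \bar R.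
  by rewrite lee_fin invr_ge0 mulr_ge0// ltW// seg_length_gt0.
apply: le_trans (lee_wpmul2l Q0 (lee_abs_sum _ _ _)) _.
rewrite ge0_sume_distrr//; apply: lee_sum => e _.
exact: net_avg_ub.
Qed.

Lemma net_norm_ge0 (p : R * R) (q : \bar R * \bar R) f : 0 <= net_norm p q f.
Proof.
apply: dtt_norm2_ge0 => t1 t2 _ _.
by rewrite mule_ge0 ?lee_fin ?mulr_ge0 ?powR_ge0// net_avg_ge0.
Qed.

Lemma net_avg_monotone f : monotone_pos (net_avg f).
Proof. by right => t s u _ _ su; split; apply: net_avg_nonincreasing. Qed.

Section KFunctional.
Variables (p0 p1 : R * R) (q0 q1 : \bar R * \bar R) (a : {mfun plane R >-> R}).

Lemma K_functional_lb (B : \bar R) (t1 t2 : R) :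
  (forall b, decomposition p0 p1 q0 q1 a b ->
    B <= \sum_(e : bool * bool) (t1 ^+ e.1 * t2 ^+ e.2)%:E
      * net_norm (mix e p0 p1) (mix e q0 q1) (b e)) ->
  B <= K_functional p0 p1 q0 q1 a t1 t2.
Proof. by move=> H; apply/ereal_infP => _ [b ab <-]; exact: H. Qed.

Lemma K_functional_ub b (t1 t2 : R) : decomposition p0 p1 q0 q1 a b ->
  K_functional p0 p1 q0 q1 a t1 t2 <=
   \sum_(e : bool * bool) (t1 ^+ e.1 * t2 ^+ e.2)%:E
      * net_norm (mix e p0 p1) (mix e q0 q1) (b e).
Proof. by move=> ab; apply: ereal_inf_lbound; exists b. Qed.

Lemma K_functional_ge0 : ge0_pos (K_functional p0 p1 q0 q1 a).
Proof.
move=> t1 t2 t10 t20; apply: K_functional_lb => b _; apply: sume_ge0 => e _.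
by rewrite mule_ge0 ?net_norm_ge0// lee_fin mulr_ge0// exprn_ge0// ltW.
Qed.

Lemma K_functional_nondecreasing (s1 s2 t1 t2 : R) :
  (0 < s1)%R -> (0 < s2)%R -> (s1 <= t1)%R -> (s2 <= t2)%R ->
  K_functional p0 p1 q0 q1 a s1 s2 <= K_functional p0 p1 q0 q1 a t1 t2.
Proof.
move=> s10 s20 st1 st2; apply: K_functional_lb => b ab.
apply: le_trans (K_functional_ub _ _ ab) _; apply: lee_sum => e _.
apply: lee_wpmul2r; first exact: net_norm_ge0.
rewrite lee_fin; apply: ler_pM; [by rewrite exprn_ge0// ltW|by rewrite exprn_ge0// ltW| |].
- by apply: lerXn2r => //; rewrite nnegrE ltW// (lt_le_trans s10).
- by apply: lerXn2r => //; rewrite nnegrE ltW// (lt_le_trans s20).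
Qed.

Lemma K_functional_monotone : monotone_pos (K_functional p0 p1 q0 q1 a).
Proof. by left => t s u t0 s0 su; split; apply: K_functional_nondecreasing. Qed.

End KFunctional.
End NetAvg.

(** * The net norm is dominated by the interpolation norm *)

Section NetNormLeInterp.
Local Open Scope ereal_scope.
Context {R : realType}.

Lemma measurable_innerZ (q : \bar R) (psi : R -> R -> \bar R) (c : R) :
  1 <= q -> (0 <= c)%R -> ge0_pos psi -> measurable_inner q psi ->
  measurable_inner q (fun t1 t2 => c%:E * psi t1 t2).
Proof.
move=> q1 c0 psi0 [m1 m2]; split=> [t2 t20|].
  by apply: emeasurable_funM => //; exact: m1.
apply: (@eq_measurable_fun _ _ _ _ _ (fun t2 => c%:E * dtt_norm q (psi ^~ t2))).
  move=> t2; rewrite inE mem_pos => t20.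
  by rewrite -dtt_normZ//; [exact: m1|move=> t t0; exact: psi0].
exact: emeasurable_funM.
Qed.

Lemma expr_bool_powR (x : R) (e : bool) : (0 < x)%R ->
  (x ^+ e = x `^ (if e then 1 else 0))%R.
Proof. by move=> x0; case: e; rewrite ?expr1 ?expr0 ?powRr1 ?powRr0// ltW. Qed.

(** With g = 1/p0 - 1/p1 the exponents satisfy 1/p = - g th + g e + 1/p^e for both values of e. This
    identity dictates the substitution t -> t^g: after it every term of the K-functional scales like
    t^(1/p). *)
Lemma interp_exponent (p0 p1 p th t : R) (e : bool) :
  (p^-1 = (1 - th) / p0 + th / p1)%R -> (0 < t)%R ->
  (t `^ p^-1 = (t `^ (p0^-1 - p1^-1)) `^ (- th) *
     ((t `^ (p0^-1 - p1^-1)) ^+ e * t `^ (if e then p1 else p0)^-1))%R.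
Proof.
move=> hp t0; rewrite expr_bool_powR ?powR_gt0// -!powRrM.
rewrite -!powRD; try by apply/implyP => _; rewrite gt_eqF.
by congr (_ `^ _)%R; rewrite hp; case: e; ring.
Qed.

Variables (p0 p1 p theta : R * R) (q0 q1 q : \bar R * \bar R).
Hypotheses (hp1 : (1 < p0.1)%R /\ (p0.1 < p1.1)%R)
  (hp2 : (1 < p0.2)%R /\ (p0.2 < p1.2)%R)
  (hq0 : 1 <= q0.1 /\ 1 <= q0.2) (hq1 : 1 <= q1.1 /\ 1 <= q1.2)
  (hq : 1 <= q.1 /\ 1 <= q.2)
  (hpt1 : ((p.1)^-1 = (1 - theta.1) / p0.1 + theta.1 / p1.1)%R)
  (hpt2 : ((p.2)^-1 = (1 - theta.2) / p0.2 + theta.2 / p1.2)%R).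

Let g1 := ((p0.1)^-1 - (p1.1)^-1)%R.
Let g2 := ((p0.2)^-1 - (p1.2)^-1)%R.

Lemma mix_q_ge1 e : 1 <= (mix e q0 q1).1 /\ 1 <= (mix e q0 q1).2.
Proof.
by move: hq0 hq1 => [? ?] [? ?]; split; rewrite /mix/=; case: ifP.
Qed.

Lemma mix_p_gt1 e : (1 < (mix e p0 p1).1)%R /\ (1 < (mix e p0 p1).2)%R.
Proof.
move: hp1 hp2 => [a b] [c d]; split; rewrite /mix/=; case: ifP => // _.
  exact: lt_trans b.
exact: lt_trans d.
Qed.

Lemma gamma1_gt0 : (0 < g1)%R.
Proof.
move: hp1 => [a b]; rewrite subr_gt0 ltf_pV2// posrE.
  by rewrite (lt_trans _ b)// (lt_trans _ a).
by rewrite (lt_trans _ a).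
Qed.

Lemma gamma2_gt0 : (0 < g2)%R.
Proof.
move: hp2 => [a b]; rewrite subr_gt0 ltf_pV2// posrE.
  by rewrite (lt_trans _ b)// (lt_trans _ a).
by rewrite (lt_trans _ a).
Qed.

Lemma net_avg_le_K : exists2 C : R, (0 < C)%R &
  forall (a : {mfun plane R >-> R}) (t1 t2 : R), (0 < t1)%R -> (0 < t2)%R ->
  (t1 `^ (p.1)^-1 * t2 `^ (p.2)^-1)%:E * net_avg a t1 t2 <=
  C%:E * (((t1 `^ g1) `^ (- theta.1) * (t2 `^ g2) `^ (- theta.2))%:E *
     K_functional p0 p1 q0 q1 a (t1 `^ g1) (t2 `^ g2)).
Proof.
have /choice[C HC] : forall e : bool * bool, exists C : R, (0 < C)%R /\
    forall (f : {mfun plane R >-> R}) (t1 t2 : R), (0 < t1)%R -> (0 < t2)%R ->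
    (t1 `^ ((mix e p0 p1).1)^-1 * t2 `^ ((mix e p0 p1).2)^-1)%:E * net_avg f t1 t2
    <= C%:E * net_norm (mix e p0 p1) (mix e q0 q1) f.
  move=> e; have [m1 m2] := mix_q_ge1 e; have [n1 n2] := mix_p_gt1 e.
  have n1' : (0 < ((mix e p0 p1).1)^-1)%R by rewrite invr_gt0 (lt_trans _ n1).
  have n2' : (0 < ((mix e p0 p1).2)^-1)%R by rewrite invr_gt0 (lt_trans _ n2).
  have [C C0 HC] := @nonincreasing_le_dtt_norm2 R (mix e q0 q1)
    ((mix e p0 p1).1)^-1 ((mix e p0 p1).2)^-1 m1 m2
    (ltW n1') (ltW n2').
  exists C; split=> // f t1 t2 t10 t20; apply: (HC (net_avg f)) => //.
  - by move=> s1 s2 _ _; exact: net_avg_ge0.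
  - by move=> s2 _ s t _ st; exact: net_avg_nonincreasing.
  - by move=> s2 _ s t _ st; exact: net_avg_nonincreasing.
pose B := (\sum_e C e)%R.
have CB e : (C e <= B)%R.
  by rewrite /B (bigD1 e)//= lerDl sumr_ge0// => e' _; apply/ltW; exact: (HC e').1.
have B0 : (0 < B)%R by exact: lt_le_trans (HC (true, true)).1 (CB _).
exists B => // a t1 t2 t10 t20.
pose D := ((t1 `^ g1) `^ (- theta.1) * (t2 `^ g2) `^ (- theta.2))%R.
have D0 : (0 < D)%R by rewrite mulr_gt0// !powR_gt0.
have BD0 : (0 < B * D)%R by exact: mulr_gt0.
(* The positive factor goes to the other side, so that the infimum can be tested one decomposition
   at a time. *)
rewrite -/D muleA -EFinM -(lee_pdivrMl _ _ BD0); apply: K_functional_lb => b [ib ab].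
rewrite (lee_pdivrMl _ _ BD0) ge0_sume_distrr; last first.
  by move=> e _; rewrite mule_ge0 ?net_norm_ge0// lee_fin mulr_ge0// exprn_ge0// powR_ge0.
have ib' e : integrable_on_rects (b e) by have [] := ib e.
apply: le_trans (lee_wpmul2l _ (net_avg_sum t1 t2 ib' ab)) _.
  by rewrite lee_fin mulr_ge0// powR_ge0.
rewrite ge0_sume_distrr; last by move=> e _; exact: net_avg_ge0.
apply: lee_sum => e _.
rewrite (interp_exponent e.1 hpt1 t10) (interp_exponent e.2 hpt2 t20) -/g1 -/g2.
set x1 := (t1 `^ g1)%R; set x2 := (t2 `^ g2)%R.
have regroup : forall a b c d e f : R,
  ((a * (b * c)) * (d * (e * f)) = (a * d * (b * e)) * (c * f))%R.
  by move=> *; ring.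
rewrite regroup -/(D).
rewrite [in X in X <= _]EFinM -muleA.
have y0 : 0 <= (D * (x1 ^+ e.1 * x2 ^+ e.2))%:E.
  by rewrite lee_fin mulr_ge0 ?(ltW D0)// mulr_ge0// exprn_ge0// powR_ge0.
apply: le_trans (lee_wpmul2l y0 ((HC e).2 (b e) _ _ t10 t20)) _.
rewrite !muleA -!EFinM; apply: lee_wpmul2r; first exact: net_norm_ge0.
rewrite lee_fin -[leRHS]mulrA [leRHS]mulrC.
by apply: ler_wpM2l => //; rewrite -lee_fin.
Qed.

Lemma net_norm_le_interp : exists2 C : R, (0 < C)%R &
  forall a : {mfun plane R >-> R},
  net_norm p q a <= C%:E * interp_norm p0 p1 q0 q1 theta q a.
Proof.
have [C C0 HC] := net_avg_le_K; have [h1 h2] := hq.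
have [c c0 Hc] := dtt_norm2_dilate h1 h2 gamma1_gt0 gamma2_gt0.
exists (c^-1 * C)%R; first by rewrite mulr_gt0// invr_gt0.
move=> a; rewrite /interp_norm.
set Phi := (X in dtt_norm2 q X).
have Phi0 : ge0_pos Phi.
  move=> t1 t2 t10 t20; rewrite /Phi mule_ge0 ?lee_fin ?mulr_ge0 ?powR_ge0//.
  exact: K_functional_ge0.
have mPhi : measurable_inner q.1 Phi.
  apply: monotone_measurable_inner => //; first exact: K_functional_ge0.
  exact: K_functional_monotone.
rewrite EFinM -muleA -dtt_norm2Z//; last exact: ltW.
rewrite lee_pdivlMl//.
rewrite [leRHS](Hc _ 1%R 1%R)//; last 2 first.
- by move=> t1 t2 t10 t20; rewrite mule_ge0 ?lee_fin ?(ltW C0)// Phi0.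
- by apply: measurable_innerZ => //; exact: ltW.
apply: lee_wpmul2l; first by rewrite lee_fin ltW.
apply: le_dtt_norm2 => // t1 t2 t10 t20.
  by rewrite mule_ge0 ?lee_fin ?mulr_ge0 ?powR_ge0// net_avg_ge0.
by rewrite !mul1r; exact: HC.
Qed.
End NetNormLeInterp.

(** * Averaging over a grid *)

Section Averaging.
Local Open Scope ereal_scope.
Context {R : realType}.
Notation mu := (@lebesgue_measure R).
Implicit Types (f g : {mfun plane R >-> R}) (J : segment R).

(** Serves functions given cell by cell on a grid: there are only countably many cells. *)
Lemma measurable_glue d d' (T : measurableType d) (T' : measurableType d')
    (k : T -> int) (g : int -> T -> T') :
  (forall n, measurable (k @^-1` [set n])) ->
  (forall n, measurable_fun [set: T] (g n)) ->
  measurable_fun [set: T] (fun x => g (k x) x).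
Proof.
move=> mk mg _ Y mY; rewrite setTI.
rewrite (_ : _ @^-1` Y = \bigcup_n (k @^-1` [set n] `&` (g n @^-1` Y))); last first.
  apply/seteqP; split=> [x /= Yx|x [n _ [/= <-]]//].
  by exists (k x).
apply: countable_bigcupT_measurable => // n; apply: measurableI => //.
by rewrite -[X in measurable X]setTI; exact: mg.
Qed.

(** Stated without integrability, since individual slices of a locally integrable function need not
    be integrable. *)
Lemma measurable_integral_fst (F : plane R -> \bar R) :
  measurable_fun [set: plane R] F ->
  measurable_fun [set: measurableTypeR R] (fun y => \int[mu]_x F (x, y)).
Proof.
move=> mF.
have -> : (fun y => \int[mu]_x F (x, y)) =
    (fun y => \int[mu]_x F^\+ (x, y)) \- (fun y => \int[mu]_x F^\- (x, y)).
  apply/funext => y; rewrite [LHS]integralE.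
  under eq_integral do rewrite funepos_comp/=.
  by under [X in _ - X = _]eq_integral do rewrite funeneg_comp/=.
apply: emeasurable_funB.
- by apply: (@measurable_fun_fubini_tonelli_G _ _ _ _ _ mu) => //; exact: measurable_funepos.
- by apply: (@measurable_fun_fubini_tonelli_G _ _ _ _ _ mu) => //; exact: measurable_funeneg.
Qed.

(* Half-open in the first variable, so that consecutive strips tile. *)
Definition strip (a b : R) (J : segment R) : set (plane R) :=
  ([set` `[a, b[] : set (measurableTypeR R)) `*` seg_set J.

Lemma measurable_strip a b J : measurable (strip a b J).
Proof. by apply: measurableX; exact: measurable_itv. Qed.

Lemma mem_strip a b J (x : plane R) :
  (x \in strip a b J) = (a <= x.1 < b)%R && (x.2 \in seg_set J).
Proof.
apply/idP/andP.
  by move/set_mem => [/=]; rewrite in_itv/= => -> /mem_set.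
by move=> [xab /set_mem xJ]; apply/mem_set; split => //=; rewrite in_itv.
Qed.

Lemma integral_indic_prod (u : measurableTypeR R -> R) (a b : R) : (a <= b)%R ->
  mu.-integrable [set: measurableTypeR R] (EFin \o u) ->
  let H := fun x : plane R => ((\1_([set` `[a, b[]) x.1 * u x.2)%R)%:E in
  (lebesgue2 R).-integrable [set: plane R] H /\
  \int[lebesgue2 R]_x H x = (b - a)%:E * \int[mu]_y (u y)%:E.
Proof.
move=> ab iu H.
have mu' : measurable_fun [set: measurableTypeR R] u.
  by apply/measurable_EFinP; exact: measurable_int iu.
have mI : measurable_fun [set: measurableTypeR R] (\1_([set` `[a, b[]) :
  measurableTypeR R -> R).
  by apply: measurable_indic; exact: measurable_itv.
have mH : measurable_fun [set: plane R] H.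
  apply/measurable_EFinP; apply: measurable_funM.
    exact: measurableT_comp mI measurable_fst.
  exact: measurableT_comp mu' measurable_snd.
have lenE : \int[mu]_x (\1_([set` `[a, b[]) x)%:E = (b - a)%:E :> \bar R.
  transitivity (lebesgue_measure ([set` `[a, b[] : set R)).
    by rewrite integral_indic// setIT.
  rewrite lebesgue_measure_itv/= lte_fin; case: ltP => [//|ba].
  by rewrite (_ : b = a) ?subrr//; apply/eqP; rewrite eq_le ab ba.
have iH : (lebesgue2 R).-integrable [set: plane R] H.
  apply/integrable12ltyP => //.
  under eq_integral.
    move=> x _.
    under eq_integral do rewrite /H/= normrM EFinM.
    rewrite ge0_integralZl//; last first.
      by apply/measurable_EFinP; apply: measurableT_comp.
    rewrite ger0_norm//.
    over.
  rewrite ge0_integralZr//.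
  - rewrite lenE lte_mul_pinfty//; first by rewrite lee_fin subr_ge0.
    by have /integrableP[_] := iu.
  - by apply/measurable_EFinP.
  - by apply: integral_ge0.
split=> //.
rewrite -(integral12_prod_meas1 iH) /fubini_F.
under eq_integral.
  move=> x _.
  under eq_integral do rewrite /H/= EFinM.
  rewrite integralZl//.
  over.
have iufin : \int[mu]_y (u y)%:E \is a fin_num.
  exact: (integrable_fin_num measurableT iu).
under eq_integral do rewrite muleC.
rewrite -(fineK iufin) integralZl//; first by rewrite lenE muleC.
exact: integrable_indic_itv.
Qed.

Lemma integral_stripD (F : plane R -> \bar R) (a b c : R) J :
  measurable_fun [set: plane R] F -> (a <= b)%R -> (b <= c)%R ->
  \int[lebesgue2 R]_(x in strip a c J) F x =
  \int[lebesgue2 R]_(x in strip a b J) F x + \int[lebesgue2 R]_(x in strip b c J) F x.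
Proof.
move=> mF ab bc.
have e : strip a c J = strip a b J `|` strip b c J.
  apply/seteqP; split=> [[x y] [/= + yJ]|[x y] [] [/= + yJ]]; rewrite in_itv/= => /andP[ax xc].
  - have [xb|bx] := ltP x b; [left|right]; split=> //=; rewrite in_itv/=.
      by rewrite ax.
    by rewrite bx.
  - by split=> //=; rewrite in_itv/= ax (lt_le_trans xc).
  - by split=> //=; rewrite in_itv/= xc (le_trans ab).
rewrite e integral_setU//; try exact: measurable_strip.
  exact: measurable_funTS.
apply/eqP; rewrite -subset0 => -[x y] [[/= + _] [/= + _]]; rewrite !in_itv/=.
by move=> /andP[_ xb] /andP[bx _]; move: (lt_le_trans xb bx); rewrite ltxx.
Qed.

Lemma integral_rect_strip (F : plane R -> \bar R) (I J : segment R) :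
  measurable_fun [set: plane R] F ->
  \int[lebesgue2 R]_(x in rect_set (I, J)) F x =
  \int[lebesgue2 R]_(x in strip (seg_lo I) (seg_hi I) J) F x.
Proof.
move=> mF; have lh := ltW (seg_lt I).
pose N : set (plane R) := [set seg_hi I] `*` seg_set J.
have mN : measurable N by apply: measurableX => //; exact: measurable_itv.
have e : rect_set (I, J) = strip (seg_lo I) (seg_hi I) J `|` N.
  apply/seteqP; split=> [[x y] [/= + yJ]|[x y] [] [/= + yJ]].
  - rewrite /seg_set/= in_itv/= => /andP[ax]; rewrite le_eqVlt => /predU1P[->|xc].
      by right.
    by left; split=> //=; rewrite in_itv/= ax.
  - rewrite in_itv/= => /andP[ax xc]; split=> //=; rewrite /seg_set/= in_itv/= ax.
    exact: ltW.
  - by move=> ->; split=> //=; rewrite /seg_set/= in_itv/= lh lexx.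
rewrite e integral_setU//; last 3 first.
- exact: measurable_strip.
- exact: measurable_funTS.
- apply/eqP; rewrite -subset0 => -[x y] [[/= + _] [/= + _]]; rewrite in_itv/=.
  by move=> /andP[_ xb] xE; move: xb; rewrite xE ltxx.
rewrite [X in _ + X](_ : _ = 0) ?adde0//.
apply: null_set_integral => //; first exact: measurable_funTS.
transitivity (mu [set seg_hi I] * mu (seg_set J)).
  by apply: product_measure1E => //; exact: measurable_itv.
by rewrite lebesgue_measure_set1 mul0e.
Qed.

Lemma integrable_strip f (a b : R) J : integrable_on_rects f ->
  (lebesgue2 R).-integrable (strip a b J) (EFin \o f).
Proof.
move=> fi; have [ab|ba] := ltP a b; last first.
  rewrite (_ : strip a b J = set0) ?integrable_set0//.
  by rewrite -subset0 => -[x y] [/= + _]; rewrite in_itv/= =>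
    /andP[/le_lt_trans/[apply]]; rewrite ltNge ba.
apply: integrableS (fi (Segment ab, J)).
- exact: measurable_rect_set.
- exact: measurable_strip.
- by move=> [x y] [/= + yJ]; rewrite in_itv/= => /andP[ax xb]; split=> //=;
    rewrite /seg_set/= in_itv/= ax ltW.
Qed.

(* [h] is the conditional expectation of [f] in the first variable with respect
   to the grid of cells [t k, t (k + 1)[. *)
Lemma exists_averaging_cell f (t : R) : integrable_on_rects f -> (0 < t)%R ->
  exists h : {mfun plane R >-> R}, forall (k : int) (a b : R) J,
    (t * k%:~R <= a)%R -> (a <= b)%R -> (b <= t * (k + 1)%:~R)%R ->
    (lebesgue2 R).-integrable (strip a b J) (EFin \o h) /\
    \int[lebesgue2 R]_(x in strip a b J) (h x)%:E =
    ((b - a) / t)%:E *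
      \int[lebesgue2 R]_(x in strip (t * k%:~R) (t * (k + 1)%:~R) J) (f x)%:E.
Proof.
move=> fi t0.
pose c (k : int) : set (measurableTypeR R) := [set` `[(t * k%:~R)%R, (t * (k + 1)%:~R)%R[].
have mc k : measurable (c k) by exact: measurable_itv.
(* For y in a null set the slice may fail to be integrable over the cell; the [fine] in [g] then
   gives 0. *)
pose S k (y : measurableTypeR R) := \int[mu]_x (f (x, y) * \1_(c k) x)%:E.
have mS k : measurable_fun setT (S k).
  have mF : measurable_fun [set: plane R] (fun x => (f x * \1_(c k) x.1)%:E).
    apply/measurable_EFinP; apply: measurable_funM => //.
    apply: (@measurableT_comp _ _ _ _ _ _ (\1_(c k) : measurableTypeR R -> R)) => //.
  exact: measurable_integral_fst mF.
pose g k (x : plane R) := (t^-1 * fine (S k x.2))%R.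
pose kk (x : plane R) : int := Num.floor (x.1 / t).
have kkE x k : (kk x == k) = (t * k%:~R <= x.1 < t * (k + 1)%:~R)%R.
  by rewrite /kk floor_eq ler_pdivlMr// ltr_pdivrMr// mulrC [(_ * t)%R]mulrC.
have mh : measurable_fun [set: plane R] (fun x => g (kk x) x).
  apply: measurable_glue => k.
    rewrite (_ : _ @^-1` _ = c k `*` setT); first exact: measurableX.
    apply/seteqP; split=> [x /= /eqP|x [+ _]].
      by rewrite kkE => xk; split=> //=; rewrite in_itv.
    by rewrite /c/= in_itv/= -kkE => /eqP.
  apply: measurable_funM => //.
  have mfS : measurable_fun [set: measurableTypeR R] (fine \o S k).
    exact: measurableT_comp (fine_measurable measurableT) (mS k).
  by apply: (@measurableT_comp _ _ _ _ _ _ (fine \o S k)).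
pose h : {mfun plane R >-> R} := HB.pack (fun x => g (kk x) x)
  (isMeasurableFun.Build _ _ _ _ (fun x => g (kk x) x) mh).
exists h => k a b J ka ab bk.
set C := strip (t * k%:~R) (t * (k + 1)%:~R) J.
pose F : plane R -> \bar R := (EFin \o f) \_ C.
have iF : (lebesgue2 R).-integrable [set: plane R] F.
  by apply: (iffLR (integrable_mkcond _ (measurable_strip _ _ _))); exact: integrable_strip.
(* By Fubini [G] is integrable, hence finite almost everywhere, so the real-valued [u] below has the
   same integral. *)
pose G := fubini_G mu F.
have mF := measurable_int _ iF.
have iG : mu.-integrable setT G.
  apply/integrableP; split; first exact: (measurable_fubini_G iF).
  apply: le_lt_trans (iffLR (integrable21ltyP _ _ mF) iF).
  apply: ge0_le_integral_lower => // y _; apply: le_abse_integral => //.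
  exact/measurableT_comp.
pose u y := fine (G y).
have mu_u : measurable_fun [set: measurableTypeR R] (EFin \o u).
  apply/measurable_EFinP; apply: (measurableT_comp (fine_measurable measurableT)).
  exact: measurable_int iG.
have iu : mu.-integrable setT (EFin \o u).
  apply: le_integrable iG => // y _ /=.
  by rewrite /u; case: (G y) => [r||] /=; rewrite ?normr0 ?leey ?lexx.
have uG : \int[mu]_y (u y)%:E = \int[mu]_y G y.
  apply: ae_eq_integral => //; first exact: (measurable_int _ iG).
  have := integrable_ae measurableT iG; apply: filterS => y /(_ I) Gfin _.
  by rewrite /u fineK.
have [iH HE] := integral_indic_prod ab iu.
(* Within one cell [h] depends on the second variable only, so on the strip it is a product
   function. *)
have hE : (EFin \o h) \_ (strip a b J) =
    (fun x => t^-1%:E * ((\1_([set` `[a, b[]) x.1 * u x.2)%R)%:E).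
  apply/funext => x; rewrite patchE mem_strip /u /G /fubini_G.
  have memE (v w y : R) : (y \in ([set` `[v, w[] : set R)) = (v <= y < w)%R.
    by rewrite mem_setE/= in_itv.
  rewrite indicE memE.
  case: ifPn => [/andP[/andP[ax xb] xJ]|].
    have xk : kk x = k.
      by apply/eqP; rewrite kkE (le_trans ka ax) (lt_le_trans xb bk).
    rewrite ax xb/= mul1r xk /g EFinM; congr (_ * (fine _)%:E).
    apply: eq_integral => y _; rewrite /F patchE mem_strip/= xJ andbT.
    rewrite indicE /c memE.
    by case: ifPn => _; rewrite ?mulr1 ?mulr0.
  rewrite negb_and => /orP[/negbTE ->|xJ]; first by rewrite mul0r mule0.
  rewrite (_ : \int[mu]_x0 _ = 0) ?mulr0 ?mule0//.
  apply: integral0_eq => y _; rewrite /F patchE mem_strip/= (negbTE xJ) andbF.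
  by [].
split.
  apply: (iffRL (integrable_mkcond _ (measurable_strip _ _ _))).
  by rewrite hE; exact: integrableZl.
rewrite integral_mkcond hE integralZl// HE uG integral21_prod_meas1//.
by rewrite /F -integral_mkcond muleA -EFinM mulrC.
Qed.

End Averaging.

(** * Splitting in one variable and representation by atoms *)

Section Atoms.
Context {R : realType}.
Implicit Types (f g h : {mfun plane R >-> R}) (I J A : segment R) (t : R).

Definition strip_integral f (a b : R) J : R :=
  fine (\int[lebesgue2 R]_(x in strip a b J) (f x)%:E)%E.

Definition rect_integral f I J : R :=
  fine (\int[lebesgue2 R]_(x in rect_set (I, J)) (f x)%:E)%E.

Lemma rect_integralE f I J : rect_integral f I J = strip_integral f (seg_lo I) (seg_hi I) J.
Proof.
rewrite /rect_integral integral_rect_strip//.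
exact: measurable_EFin_mfun.
Qed.

Lemma strip_integralK f a b J : integrable_on_rects f ->
  ((strip_integral f a b J)%:E = \int[lebesgue2 R]_(x in strip a b J) (f x)%:E)%E.
Proof.
move=> fi; rewrite fineK//.
exact: (integrable_fin_num (measurable_strip a b J) (integrable_strip a b J fi)).
Qed.

Lemma strip_integralD f a b c J : integrable_on_rects f -> a <= b -> b <= c ->
  strip_integral f a c J = strip_integral f a b J + strip_integral f b c J.
Proof.
move=> fi ab bc; apply: EFin_inj; rewrite EFinD !strip_integralK//.
by apply: integral_stripD => //; exact: measurable_EFin_mfun.
Qed.

Lemma strip_integral0 f a J : strip_integral f a a J = 0.
Proof.
rewrite /strip_integral (_ : strip a a J = set0) ?integral_set0//.
rewrite -subset0 => -[x y] [/= + _]; rewrite in_itv/=.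
by move=> /andP[/le_lt_trans/[apply]]; rewrite ltxx.
Qed.

(** The first formula serves the cells cut by an endpoint of a side, the second the block of whole
    cells between them; the second follows from the first by adding one cell at a time. *)
Lemma exists_averaging f t : integrable_on_rects f -> 0 < t ->
  exists h, [/\ integrable_on_rects h,
    forall (k : int) (a b : R) J, t * k%:~R <= a -> a <= b -> b <= t * (k + 1)%:~R ->
      strip_integral h a b J = (b - a) / t * strip_integral f (t * k%:~R) (t * (k + 1)%:~R) J &
    forall (k l : int) J, k <= l -> strip_integral h (t * k%:~R) (t * l%:~R) J =
      strip_integral f (t * k%:~R) (t * l%:~R) J].
Proof.
move=> fi t0; have [h hP] := exists_averaging_cell fi t0.
have le_cell (k : int) : t * k%:~R <= t * (k + 1)%:~R.
  by rewrite ler_pM2l// ler_int lerDl.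
have ih k n J : ((lebesgue2 R).-integrable
    (strip (t * k%:~R) (t * (k + n%:Z)%:~R) J) (EFin \o h)).
  elim: n => [|n ihn].
    rewrite addr0 (_ : strip _ _ J = set0) ?integrable_set0//.
    rewrite -subset0 => -[x y] [/= + _]; rewrite in_itv/=.
    by move=> /andP[/le_lt_trans/[apply]]; rewrite ltxx.
  apply/integrableP; split; first exact: measurable_EFin_mfun.
  have [cell _] := hP (k + n%:Z) _ _ J (lexx _) (le_cell _) (lexx _).
  have e : (k + n.+1%:Z)%R = (k + n%:Z + 1)%R by rewrite -addn1 PoszD addrA.
  rewrite e (@integral_stripD _ _ _ (t * (k + n%:Z)%:~R))//.
  - apply: lte_add_pinfty; first by have /integrableP[] := ihn.
    by have /integrableP[] := cell.
  - by apply: measurableT_comp => //; exact: measurable_EFin_mfun.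
  - by rewrite ler_pM2l// ler_int lerDl.
have hi : integrable_on_rects h.
  (* Finitely many cells, starting with the one that contains the left end, cover the rectangle. *)
  move=> [I J]; pose k := Num.floor (seg_lo I / t).
  pose n := Num.bound `|seg_hi I / t - k%:~R|.
  have kI : t * k%:~R <= seg_lo I by rewrite mulrC -ler_pdivlMr// floor_le.
  have In : seg_hi I < t * (k + n%:Z)%:~R.
    rewrite mulrC -ltr_pdivrMr// intrD -ltrBlDl.
    apply: le_lt_trans (ler_norm _) _; by rewrite -pmulrn; exact: archi_boundP.
  apply: integrableS (ih k n J).
  - exact: measurable_strip.
  - exact: measurable_rect_set.
  - move=> [x y] [/= + yJ]; rewrite /seg_set/= in_itv/= => /andP[ax xb].
    by split=> //=; rewrite in_itv/= (le_trans kI)// (le_lt_trans xb).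
have cellP (k : int) a b J : t * k%:~R <= a -> a <= b -> b <= t * (k + 1)%:~R ->
    strip_integral h a b J = (b - a) / t * strip_integral f (t * k%:~R) (t * (k + 1)%:~R) J.
  move=> ka ab bk; apply: EFin_inj; rewrite EFinM !strip_integralK//.
  by have [] := hP k a b J ka ab bk.
exists h; split=> // k l J kl.
have [n ->] : exists n : nat, l = k + n%:Z.
  by exists (absz (l - k)); rewrite gez0_abs ?subr_ge0//; ring.
elim: n => [|n ihn]; first by rewrite addr0 !strip_integral0.
have e : (k + n.+1%:Z)%R = (k + n%:Z + 1)%R by rewrite -addn1 PoszD addrA.
have kn : t * k%:~R <= t * (k + n%:Z)%:~R by rewrite ler_pM2l// ler_int lerDl.
rewrite e (strip_integralD J hi kn (le_cell _))
  (strip_integralD J fi kn (le_cell _)) ihn; congr (_ + _).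
rewrite (cellP (k + n%:Z))// -mulrBr -intrB [_ + 1]addrC addrK mulr1 divff ?mul1r//.
by rewrite gt_eqF.
Qed.

(* The dyadic scale of an atom, relative to the grid step: above the step for the
   averaged part ([e = true]) and below it for the remainder ([e = false]). *)
Definition scale (e : bool) (n : nat) : R := if e then 2 ^+ n else 2^-1 ^+ n.

Lemma scale_gt0 e n : 0 < scale e n.
Proof. by rewrite /scale; case: e; rewrite exprn_gt0. Qed.

Lemma exists_pow2 (y : R) : 1 <= y -> exists n, 2 ^+ n <= y < 2 ^+ n.+1.
Proof.
move=> y1; have ex : exists n, y < 2 ^+ n.+1.
  exists (Num.bound y); apply: lt_le_trans (upper_nthrootP (leqnn _)) _.
  by rewrite ler_eXn2l// ltr1n.
case: (ex_minnP ex) => -[|m] ym minm.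
  by exists 0%N; rewrite expr0 y1.
exists m.+1; rewrite ym andbT leNgt; apply/negP => /minm.
by rewrite ltnn.
Qed.

Lemma exists_scale (e : bool) t (u : R) : 0 < u -> (if e then t <= u else u <= t) -> 0 < t ->
  exists n, scale e n * t <= u /\ u <= 2 * (scale e n * t).
Proof.
move=> u0 + t0; case: e => ut.
  have [|n /andP[n1 n2]] := @exists_pow2 (u / t); first by rewrite ler_pdivlMr// mul1r.
  exists n; rewrite /scale; split; first by rewrite -ler_pdivlMr.
  by rewrite mulrA -exprS -ler_pdivrMr// ltW.
have [|n /andP[n1 n2]] := @exists_pow2 (t / u); first by rewrite ler_pdivlMr// mul1r.
(* From 2^n <= t / u < 2^(n+1), the scale below u is t / 2^(n+1), one index further than in the
   averaged case. *)
exists n.+1; rewrite /scale; split.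
  by rewrite exprVn mulrC ler_pdivrMr ?exprn_gt0// mulrC -ler_pdivrMr// ltW.
rewrite mulrA exprS mulrA divff// mul1r exprVn mulrC ler_pdivlMr ?exprn_gt0//.
by rewrite mulrC -ler_pdivlMr.
Qed.

(* An atom [(c, A)] stands for the functional [c * \int_A]. *)
Definition atom_ok t e I (a : R * segment R) := exists n : nat,
  scale e n * t <= seg_length a.2 /\
  `|a.1| * seg_length a.2 <= 2 * Num.min (seg_length I) (scale e n * t).

(** Rounding |A| down to a dyadic scale loses at most a factor 2, which is the 2 in [atom_ok]. *)
Lemma atom_one t e I A : 0 < t ->
  (if e then t <= seg_length A else seg_length A <= t) ->
  seg_length A <= seg_length I -> atom_ok t e I (1, A).
Proof.
move=> t0 tA AI; have A0 := seg_length_gt0 A.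
have [n [n1 n2]] := exists_scale A0 tA t0.
exists n; split=> //=; rewrite normr1 mul1r minr_pMr// le_min n2 andbT.
by apply: le_trans AI _; rewrite mulr_natl mulr2n lerDl ltW// seg_length_gt0.
Qed.

(** A cut cell enters the average as the whole cell weighted by u / t, where |u| is the length of
    its part inside I. Scale index 0 is the step itself, so such an atom suits both values of
    [e]. *)
Lemma atom_cell t e I A (u : R) : 0 < t -> seg_length A = t -> `|u| <= t ->
  `|u| <= seg_length I -> atom_ok t e I (u / t, A).
Proof.
move=> t0 At ut uI; exists 0%N.
have -> : scale e 0 = 1 by rewrite /scale; case: e; rewrite expr0.
rewrite mul1r /= At; split=> //.
rewrite normrM normfV (gtr0_norm t0) divfK ?gt_eqF// minr_pMr// le_min.
by apply/andP; split; [apply: le_trans uI _|apply: le_trans ut _];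
  rewrite mulr_natl mulr2n lerDl ltW// seg_length_gt0.
Qed.

Lemma ord4_ind (P : 'I_4 -> Prop) :
  (forall (i : nat) (lt_i : (i < 4)%N), P (Ordinal lt_i)) -> forall i, P i.
Proof. by move=> H [i lti]. Qed.

(* Whole cells inside [I] contribute the same to [f] and to its average, so
   only the cells containing the endpoints of [I] matter. Every family of atoms
   is padded to four by atoms with coefficient zero. *)
Lemma exists_split_fst f t : integrable_on_rects f -> 0 < t ->
  exists g : bool -> {mfun plane R >-> R},
    (forall x, f x = g true x + g false x) /\
    forall e, integrable_on_rects (g e) /\
      forall I, exists a : 'I_4 -> R * segment R,
        (forall i, atom_ok t e I (a i)) /\
        forall J, rect_integral (g e) I J = \sum_i (a i).1 * rect_integral f (a i).2 J.
Proof.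
move=> fi t0; have [h [hi cellP gridP]] := exists_averaging fi t0.
have mfh : measurable_fun [set: plane R] (fun x => f x - h x) by exact: measurable_funB.
pose fh : {mfun plane R >-> R} := HB.pack (fun x => f x - h x)
  (isMeasurableFun.Build _ _ _ _ (fun x => f x - h x) mfh).
have fhi : integrable_on_rects fh.
  move=> Q; have iB := integrableB (measurable_rect_set Q) (fi Q) (hi Q).
  apply: eq_integrable iB => //; exact: measurable_rect_set.
have rfh I J : rect_integral fh I J = rect_integral f I J - rect_integral h I J.
  rewrite /rect_integral; apply: RintegralB; first exact: measurable_rect_set.
  exact: fi. exact: hi.
exists (fun e => if e then h else fh); split.
  by move=> x /=; rewrite addrC subrK.
have cell_lt (k : int) : t * k%:~R < t * (k + 1)%:~R.
  by rewrite ltr_pM2l// ltr_int ltrDl.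
pose cell (k : int) := Segment (cell_lt k).
have cell_len k : seg_length (cell k) = t.
  by rewrite /seg_length/= -mulrBr -intrB [_ + 1]addrC addrK mulr1.
have main I : exists a b : 'I_4 -> R * segment R,
    [/\ forall i, atom_ok t true I (a i), forall i, atom_ok t false I (b i),
      forall J, rect_integral h I J = \sum_i (a i).1 * rect_integral f (a i).2 J &
      forall J, rect_integral f I J - rect_integral h I J =
        \sum_i (b i).1 * rect_integral f (b i).2 J].
  (* Ceiling minus one places the right end in []t l, t (l + 1)]], so that the last piece has
     positive length, as a [segment] must. *)
  pose k := Num.floor (seg_lo I / t); pose l := Num.ceil (seg_hi I / t) - 1.
  have lo_hi := seg_lt I.
  have k1 : t * k%:~R <= seg_lo I by rewrite mulrC -ler_pdivlMr// floor_le.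
  have k2 : seg_lo I < t * (k + 1)%:~R by rewrite mulrC -ltr_pdivrMr// floorD1_gt.
  have l1 : t * l%:~R < seg_hi I.
    by rewrite mulrC -ltr_pdivlMr// ceilB1_lt.
  have l2 : seg_hi I <= t * (l + 1)%:~R.
    by rewrite /l subrK mulrC -ler_pdivrMr// ceil_ge.
  have kl : k <= l.
    rewrite /l lerBrDr lezD1 ceil_gt_int; apply: le_lt_trans (floor_le _) _.
    by rewrite ltr_pM2r ?invr_gt0.
  have I0 := seg_length_gt0 I.
  have zero_atom e : atom_ok t e I (0 / t, cell k).
    by apply: atom_cell => //; rewrite normr0// ltW.
  (* If k = l a single cell contains I, and the averaged function integrates to the proportion |I| /
     t of that cell. *)
  move: kl; rewrite le_eqVlt => /predU1P[kl|kl].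
    have It : seg_length I <= t.
      by rewrite -(cell_len k) /seg_length/= lerB// kl.
    exists (fun i : 'I_4 => nth (0 / t, cell k) [:: (seg_length I / t, cell k)] i).
    exists (fun i : 'I_4 => nth (0 / t, cell k)
      [:: (1, I); (- seg_length I / t, cell k)] i).
    have rh J : rect_integral h I J = seg_length I / t * rect_integral f (cell k) J.
      by rewrite !rect_integralE; apply: cellP => //; [exact: ltW|rewrite kl].
    split.
    - apply: ord4_ind => -[|i] lti /=; last by rewrite nth_nil.
      by apply: atom_cell => //; rewrite gtr0_norm.
    - apply: ord4_ind => -[|[|i]] lti /=; last by rewrite nth_nil.
        exact: atom_one.
      by apply: atom_cell => //; rewrite normrN gtr0_norm.
    - by move=> J; rewrite !big_ord_recl big_ord0 /= rh !mul0r !addr0.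
    - by move=> J; rewrite !big_ord_recl big_ord0 /= rh !mul0r !addr0 mul1r mulNr mulNr.
  have kl1 : k + 1 <= l by rewrite lezD1.
  have kl1t : t * (k + 1)%:~R <= t * l%:~R by rewrite ler_pM2l// ler_int.
  pose L := Segment k2; pose Rr := Segment l1.
  have L0 := seg_length_gt0 L; have R0 := seg_length_gt0 Rr.
  have Lt : seg_length L <= t by rewrite -(cell_len k) /seg_length/= lerB.
  have Rt : seg_length Rr <= t by rewrite -(cell_len l) /seg_length/= lerB.
  have LI : seg_length L <= seg_length I.
    by rewrite /seg_length/= lerB// (le_trans kl1t)// ltW.
  have RI : seg_length Rr <= seg_length I.
    by rewrite /seg_length/= lerB// (le_trans _ kl1t)// ltW.
  have rh J : rect_integral h I J = seg_length L / t * rect_integral f (cell k) J +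
      strip_integral f (t * (k + 1)%:~R) (t * l%:~R) J +
        seg_length Rr / t * rect_integral f (cell l) J.
    rewrite !rect_integralE (strip_integralD J hi (ltW k2));
      last by apply: le_trans kl1t _; exact: ltW.
    rewrite (strip_integralD J hi kl1t (ltW l1)) addrA gridP//; congr (_ + _ + _).
      by apply: cellP => //; exact: ltW.
    by apply: cellP => //; exact: ltW.
  have rf J : rect_integral f I J = rect_integral f L J +
    strip_integral f (t * (k + 1)%:~R) (t * l%:~R) J + rect_integral f Rr J.
    rewrite !rect_integralE (strip_integralD J fi (ltW k2));
      last by apply: le_trans kl1t _; exact: ltW.
    by rewrite (strip_integralD J fi kl1t (ltW l1)) addrA.
  have atomsb : exists b : 'I_4 -> R * segment R,
      (forall i, atom_ok t false I (b i)) /\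
      forall J, rect_integral f I J - rect_integral h I J =
        \sum_i (b i).1 * rect_integral f (b i).2 J.
    exists (fun i : 'I_4 => nth (0 / t, cell k)
      [:: (1, L); (- seg_length L / t, cell k); (1, Rr); (- seg_length Rr / t, cell l)] i).
    split.
      apply: ord4_ind => -[|[|[|[|i]]]] lti //=.
      - exact: atom_one.
      - by apply: atom_cell => //; rewrite normrN gtr0_norm.
      - exact: atom_one.
      - by apply: atom_cell => //; rewrite normrN gtr0_norm.
    move=> J; rewrite !big_ord_recl big_ord0 /= rh rf !mul1r.
    by rewrite !mulNr; ring.
  have [b [b1 b2]] := atomsb.
  (* Adjacent cells leave an empty middle block, which is not a [segment]; otherwise the middle
     block contains a whole cell and is at least t long. *)
  move: kl1; rewrite le_eqVlt => /predU1P[kl1|kl1].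
    exists (fun i : 'I_4 => nth (0 / t, cell k)
      [:: (seg_length L / t, cell k); (seg_length Rr / t, cell l)] i), b; split=> //.
      apply: ord4_ind => -[|[|i]] lti /=; last by rewrite nth_nil.
        by apply: atom_cell => //; rewrite gtr0_norm.
      by apply: atom_cell => //; rewrite gtr0_norm.
    by move=> J; rewrite !big_ord_recl big_ord0 /= rh kl1 strip_integral0 !mul0r !addr0.
  have kl2 : t * (k + 1)%:~R < t * l%:~R by rewrite ltr_pM2l// ltr_int.
  pose Mid := Segment kl2.
  exists (fun i : 'I_4 => nth (0 / t, cell k)
      [:: (seg_length L / t, cell k); (1, Mid); (seg_length Rr / t, cell l)] i), b; split=> //.
    apply: ord4_ind => -[|[|[|i]]] lti /=; last by rewrite nth_nil.
    - by apply: atom_cell => //; rewrite gtr0_norm.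
    - apply: atom_one => //.
        have d1 : (1 : R) <= (l - (k + 1))%:~R by rewrite ler1z lerBrDr addrC lezD1.
        by rewrite /seg_length/= -mulrBr -[X in X <= _]mulr1 ler_pM2l// -intrB.
      by rewrite /seg_length/= lerB// ltW.
    - by apply: atom_cell => //; rewrite gtr0_norm.
  move=> J; rewrite !big_ord_recl big_ord0 /= rh !mul0r !addr0 mul1r
    [rect_integral f Mid J]rect_integralE.
  by rewrite addrA.
case; split=> // I; have [a [b [a1 b1 a2 b2]]] := main I.
  by exists a.
by exists b; split=> // J; rewrite rfh.
Qed.
End Atoms.

(** * Reflection of the plane, and splitting in both variables *)

Section Swap.
Local Open Scope ereal_scope.
Context {R : realType}.
Implicit Types (f g h : {mfun plane R >-> R}) (I J A : segment R).

(** The reflected measure agrees with the product measure on products, hence everywhere by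
    uniqueness. It transports the splitting in the first variable to the second. *)
Lemma ge0_integral_swap d (T : measurableType d)
    (m : {sigma_finite_measure set T -> \bar R}) (D : set (T * T)) (F : T * T -> \bar R) :
  measurable D -> measurable_fun [set: T * T] F -> (forall x, 0 <= F x) ->
  \int[(m \x m)]_(x in swap @^-1` D) F (swap x) = \int[(m \x m)]_(x in D) F x.
Proof.
move=> mD mF F0.
have msw : measurable_fun [set: T * T] (@swap T T) by exact: measurable_swap.
transitivity (\int[pushforward (m \x m) (@swap T T)]_(x in D) F x).
  by rewrite ge0_integral_pushforward//; exact: measurable_funTS.
apply: eq_measure_integral => A mA _; apply/esym.
apply: product_measure_unique => // B C mB mC.
transitivity ((m \x m) (C `*` B)).
  rewrite [LHS](_ : _ = (m \x m) (@swap T T @^-1` (B `*` C)))//; congr (_ _).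
  by apply/seteqP; split=> [[x y] []|[x y] []].
by rewrite [LHS]product_measure1E// muleC.
Qed.

Lemma integral_swap d (T : measurableType d)
    (m : {sigma_finite_measure set T -> \bar R}) (D : set (T * T)) (F : T * T -> \bar R) :
  measurable D -> measurable_fun [set: T * T] F ->
  \int[(m \x m)]_(x in swap @^-1` D) F (swap x) = \int[(m \x m)]_(x in D) F x.
Proof.
move=> mD mF; rewrite [LHS]integralE [RHS]integralE.
congr (_ - _).
- rewrite -[RHS]ge0_integral_swap//; last first.
    by apply: measurable_funepos.
  by apply: eq_integral => x _; rewrite -[RHS]/((F^\+ \o swap) x) -funepos_comp.
- rewrite -[RHS]ge0_integral_swap//; last first.
    by apply: measurable_funeneg.
  by apply: eq_integral => x _; rewrite -[RHS]/((F^\- \o swap) x) -funeneg_comp.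
Qed.

Lemma rect_set_swap I J : rect_set (I, J) = swap @^-1` (rect_set (J, I)).
Proof. by apply/seteqP; split=> [[x y] []|[x y] []]. Qed.

Lemma exists_swap f : exists g : {mfun plane R >-> R},
  [/\ forall x, g x = f (swap x),
    integrable_on_rects f -> integrable_on_rects g &
    forall I J, rect_integral g I J = rect_integral f J I].
Proof.
have mg : measurable_fun [set: plane R] (f \o @swap (measurableTypeR R) (measurableTypeR R)).
  apply: measurableT_comp => //; exact: measurable_swap.
pose g : {mfun plane R >-> R} := HB.pack (f \o @swap (measurableTypeR R) (measurableTypeR R))
  (isMeasurableFun.Build _ _ _ _ (f \o @swap (measurableTypeR R) (measurableTypeR R)) mg).
exists g; split=> // [fi [I J]|I J].
  apply/integrableP; split; first exact: measurable_EFin_mfun.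
  rewrite rect_set_swap (@ge0_integral_swap _ _ (@lebesgue_measure R) _
    (fun x => `|(f x)%:E|))//.
  - by have /integrableP[] := fi (J, I).
  - exact: measurable_rect_set.
  - by apply: measurableT_comp => //; exact: measurable_EFin_mfun.
rewrite /rect_integral rect_set_swap (@integral_swap _ _ (@lebesgue_measure R) _
  (EFin \o f))//.
- exact: measurable_rect_set.
- exact: measurable_EFin_mfun.
Qed.

Lemma exists_split_snd f (t : R) : integrable_on_rects f -> (0 < t)%R ->
  exists g : bool -> {mfun plane R >-> R},
    (forall x, f x = g true x + g false x)%R /\
    forall e, integrable_on_rects (g e) /\
      forall J, exists a : 'I_4 -> R * segment R,
        (forall i, atom_ok t e J (a i)) /\
        forall I, rect_integral (g e) I J = (\sum_i (a i).1 * rect_integral f I (a i).2)%R.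
Proof.
move=> fi t0; have [f' [f'E f'i f'r]] := exists_swap f.
have [g' [g'E g'P]] := exists_split_fst (f'i fi) t0.
have /choice[g gP] : forall e, exists g : {mfun plane R >-> R},
    [/\ forall x, g x = g' e (swap x),
      integrable_on_rects (g' e) -> integrable_on_rects g &
      forall I J, rect_integral g I J = rect_integral (g' e) J I].
  by move=> e; exact: exists_swap.
exists g; split=> [[x y]|e].
  have [-> _ _] := gP true; have [-> _ _] := gP false.
  by rewrite -g'E f'E.
have [_ gi gr] := gP e; have [g'i g'a] := g'P e.
split; first exact: gi.
move=> J; have [a [a1 a2]] := g'a J; exists a; split=> // I.
by rewrite gr a2; apply: eq_bigr => i _; rewrite f'r.
Qed.

(** The atoms of a one-variable splitting depend on the side in that variable alone and represent
    the integral for every other side. The two splittings therefore compose, with 4 times 4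
    terms. *)
Lemma exists_split f (t1 t2 : R) : integrable_on_rects f -> (0 < t1)%R -> (0 < t2)%R ->
  exists b : bool * bool -> {mfun plane R >-> R},
    (forall x, f x = \sum_e b e x)%R /\
    forall e, integrable_on_rects (b e) /\
      forall I J, exists a a' : 'I_4 -> R * segment R,
        [/\ forall i, atom_ok t1 e.1 I (a i), forall j, atom_ok t2 e.2 J (a' j) &
        rect_integral (b e) I J =
          (\sum_i \sum_j (a i).1 * (a' j).1 * rect_integral f (a i).2 (a' j).2)%R].
Proof.
move=> fi t10 t20; have [g [gE gP]] := exists_split_snd fi t20.
have /choice[h hP] : forall e2, exists h : bool -> {mfun plane R >-> R},
    (forall x, g e2 x = h true x + h false x)%R /\
    forall e, integrable_on_rects (h e) /\
      forall I, exists a : 'I_4 -> R * segment R,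
        (forall i, atom_ok t1 e I (a i)) /\
        forall J, rect_integral (h e) I J =
          (\sum_i (a i).1 * rect_integral (g e2) (a i).2 J)%R.
  by move=> e2; apply: exists_split_fst => //; have [] := gP e2.
exists (fun e => h e.2 e.1); split=> [x|[e1 e2]/=].
  rewrite gE (hP true).1 (hP false).1.
  rewrite -(pair_bigA _ (fun e1 e2 => h e2 e1 x))/= !big_bool/=.
  by rewrite addrACA.
have [hi ha] := (hP e2).2 e1; split=> // I J.
have [a [a1 a2]] := ha I; have [_ ga] := gP e2; have [a' [a1' a2']] := ga J.
exists a, a'; split=> //; rewrite a2; apply: eq_bigr => i _.
by rewrite a2' mulr_sumr; apply: eq_bigr => j _; rewrite mulrA.
Qed.

End Swap.

(** * Averages and net norms of the four pieces *)

Section AtomBounds.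
Local Open Scope ereal_scope.
Context {R : realType}.
Implicit Types (f b : {mfun plane R >-> R}) (I J A : segment R).

Lemma rect_integralK f I J : integrable_on_rects f ->
  (`|rect_integral f I J|)%:E = `|\int[lebesgue2 R]_(x in rect_set (I, J)) (f x)%:E|.
Proof.
move=> fi; have fin : \int[lebesgue2 R]_(x in rect_set (I, J)) (f x)%:E \is a fin_num.
  exact: (integrable_fin_num (measurable_rect_set (I, J)) (fi (I, J))).
by rewrite -[in RHS](fineK fin).
Qed.

Lemma rect_integral_le_net_avg f (A B : segment R) (s t : R) : integrable_on_rects f ->
  (s <= seg_length A)%R -> (t <= seg_length B)%R ->
  (`|rect_integral f A B|)%:E <= (seg_length A * seg_length B)%:E * net_avg f s t.
Proof.
move=> fi sA tB; have AB : (0 < seg_length A * seg_length B)%R.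
  by rewrite mulr_gt0// seg_length_gt0.
rewrite -lee_pdivrMl//; apply: le_trans (net_avg_ub (Q := (A, B)) f sA tB).
by rewrite -rect_integralK.
Qed.

Lemma min_div_le (x t s l : R) : (0 < s)%R -> (s <= l)%R -> (0 < t)%R ->
  (x <= 2 * Num.min l t)%R -> (l^-1 * x <= 2 * Num.min 1 (t / s))%R.
Proof.
move=> s0 sl t0 xl; have l0 : (0 < l)%R by exact: lt_le_trans sl.
rewrite mulrC ler_pdivrMr//; apply: le_trans xl _.
rewrite -mulrA ler_pM2l// minr_pMl ?(ltW l0)// le_min mul1r ge_min lexx/=.
rewrite ge_min; apply/orP; right.
by rewrite -mulrA ler_peMr ?(ltW t0)// mulrC ler_pdivlMr// mul1r.
Qed.

(** The scales of the atoms vary with the rectangle, so each of the 16 terms is bounded by the whole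
    double series. The constant is 64 = 16 * 2 * 2, with one 2 from [atom_ok] in each variable. *)
Lemma net_avg_le_series f b (e : bool * bool) (t1 t2 s1 s2 : R) :
  integrable_on_rects f -> integrable_on_rects b ->
  (0 < t1)%R -> (0 < t2)%R -> (0 < s1)%R -> (0 < s2)%R ->
  (forall I J, exists a a' : 'I_4 -> R * segment R,
    [/\ forall i, atom_ok t1 e.1 I (a i), forall j, atom_ok t2 e.2 J (a' j) &
      rect_integral b I J =
        (\sum_i \sum_j (a i).1 * (a' j).1 * rect_integral f (a i).2 (a' j).2)%R]) ->
  net_avg b s1 s2 <= \sum_(n <oo) \sum_(m <oo)
    (64 * (Num.min 1 (scale e.1 n * t1 / s1) * Num.min 1 (scale e.2 m * t2 / s2)))%:E
     * net_avg f (scale e.1 n * t1) (scale e.2 m * t2).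
Proof.
move=> fi bi t10 t20 s10 s20 atoms.
have tau0 e' n (t : R) : (0 < t)%R -> (0 < scale e' n * t)%R.
  by move=> t0; rewrite mulr_gt0// scale_gt0.
pose term n m := (4 * (Num.min 1 (scale e.1 n * t1 / s1) *
  Num.min 1 (scale e.2 m * t2 / s2)))%:E
     * net_avg f (scale e.1 n * t1) (scale e.2 m * t2).
have min0 (x : R) : (0 < x)%R -> (0 <= Num.min 1 x)%R by move=> x0; rewrite le_min ler01 ltW.
have term0 n m : 0 <= term n m.
  rewrite /term mule_ge0 ?net_avg_ge0// lee_fin mulr_ge0// mulr_ge0//;
  by rewrite min0// divr_gt0// tau0.
pose S := \sum_(n <oo) \sum_(m <oo) term n m.
have rowS n : 0 <= \sum_(m <oo) term n m by apply: nneseries_ge0.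
have termS n m : term n m <= S.
  apply: (@le_trans _ _ (\sum_(m <oo) term n m)).
    rewrite (nneseriesD1 _ _ (n := m))//= leeDl//; apply: nneseries_ge0 => //.
  by rewrite /S [leRHS](nneseriesD1 _ _ (n := n))//= leeDl//; apply: nneseries_ge0.
apply: (@le_trans _ _ (16%:E * S)); last first.
  rewrite /S -nneseriesZl//; apply: lee_nneseries => [n _ _|n _].
    by rewrite mule_ge0// lee_fin.
  rewrite -nneseriesZl//; apply: lee_nneseries => [m _ _|m _].
    by rewrite mule_ge0// lee_fin.
  by rewrite /term muleA -EFinM !mulrA -natrM.
apply: net_avg_lub => -[I J] /= sI sJ.
have [a [a' [ok ok' rE]]] := atoms I J.
have I0 := seg_length_gt0 I; have J0 := seg_length_gt0 J.
rewrite -rect_integralK// -EFinM rE.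
apply: (@le_trans _ _ (\sum_(i < 4) \sum_(j < 4) ((seg_length I * seg_length J)^-1 *
    (`|(a i).1| * `|(a' j).1| * `|rect_integral f (a i).2 (a' j).2|))%:E)).
  under [leRHS]eq_bigr do rewrite sumEFin.
  rewrite sumEFin lee_fin.
  rewrite (le_trans (ler_wpM2l _ (ler_norm_sum _ _ _)))//.
    by rewrite invr_ge0 mulr_ge0// ltW.
  rewrite mulr_sumr; apply: ler_sum => i _.
  rewrite (le_trans (ler_wpM2l _ (ler_norm_sum _ _ _)))//.
    by rewrite invr_ge0 mulr_ge0// ltW.
  rewrite mulr_sumr; apply: ler_sum => j _.
  by rewrite !normrM.
apply: (@le_trans _ _ (\sum_(i < 4) \sum_(j < 4) S)); last first.
  by rewrite !sumr_const !card_ord -mulrnA mule_natl.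
apply: lee_sum => i _; apply: lee_sum => j _.
have [n [n1 n2]] := ok i; have [m [m1 m2]] := ok' j.
apply: le_trans (termS n m).
pose k := ((seg_length I * seg_length J)^-1 * (`|(a i).1| * `|(a' j).1|))%R.
have k0 : (0 <= k)%R by rewrite mulr_ge0 ?invr_ge0 ?mulr_ge0// ltW.
rewrite mulrA EFinM -/k.
have k0' : 0 <= k%:E by rewrite lee_fin.
apply: le_trans (lee_wpmul2l k0' (rect_integral_le_net_avg fi n1 m1)) _.
rewrite muleA -EFinM; apply: lee_wpmul2r; first exact: net_avg_ge0.
rewrite lee_fin (_ : _ * _ = ((seg_length I)^-1 * (`|(a i).1| * seg_length (a i).2)) *
  ((seg_length J)^-1 * (`|(a' j).1| * seg_length (a' j).2)))%R; last first.
  have regroup : forall x y c c' u v : R,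
    (x * y * (c * c') * (u * v) = x * (c * u) * (y * (c' * v)))%R.
    by move=> *; ring.
  by rewrite /k invfM; apply: regroup.
have h1 := min_div_le s10 sI (tau0 _ _ _ t10) n2.
have h2 := min_div_le s20 sJ (tau0 _ _ _ t20) m2.
apply: (@le_trans _ _ ((2 * Num.min 1 (scale e.1 n * t1 / s1)) *
  (2 * Num.min 1 (scale e.2 m * t2 / s2)))%R).
  apply: ler_pM => //; rewrite mulr_ge0 ?invr_ge0 ?(ltW I0) ?(ltW J0)// mulr_ge0//;
  exact/ltW/seg_length_gt0.
by rewrite mulrACA -natrM.
Qed.
End AtomBounds.

Section NormAtoms.
Local Open Scope ereal_scope.
Context {R : realType}.
Implicit Types (f b : {mfun plane R >-> R}).

Lemma eq_measurable_inner (q : \bar R) (psi1 psi2 : R -> R -> \bar R) :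
  (forall t1 t2 : R, (0 < t1)%R -> (0 < t2)%R -> psi1 t1 t2 = psi2 t1 t2) ->
  measurable_inner q psi1 -> measurable_inner q psi2.
Proof.
move=> e [m1 m2]; split=> [t2 t20|].
  apply: eq_measurable_fun (m1 _ t20) => t1; rewrite inE mem_pos => t10.
  exact: e.
apply: eq_measurable_fun m2 => t2; rewrite inE mem_pos => t20.
by apply: eq_dtt_norm => t1 t10; exact: e.
Qed.

Lemma nneseries2Zl (c : R) (F : nat -> nat -> \bar R) : (0 <= c)%R ->
  (forall n m, 0 <= F n m) ->
  \sum_(n <oo) \sum_(m <oo) (c%:E * F n m) = c%:E * \sum_(n <oo) \sum_(m <oo) F n m.
Proof.
move=> c0 F0; rewrite -nneseriesZl; last by move=> n _; exact: nneseries_ge0.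
by apply: eq_eseriesr => n _; rewrite nneseriesZl.
Qed.

(** In the variables s the bound on the averages is a series of products of functions min(1, tau /
    s). Minkowski's inequality takes the norm termwise, and [dtt_norm_powR_min] turns each factor
    into tau^(1/p); [q] survives only in the constant. *)
Lemma net_norm_le_series (p : R * R) (q : \bar R * \bar R) :
  (1 < p.1)%R -> (1 < p.2)%R -> 1 <= q.1 -> 1 <= q.2 ->
  exists2 C : R, (0 < C)%R & forall f b (e : bool * bool) (t1 t2 : R),
  integrable_on_rects f -> integrable_on_rects b ->
  (0 < t1)%R -> (0 < t2)%R ->
  (forall I J, exists a a' : 'I_4 -> R * segment R,
    [/\ forall i, atom_ok t1 e.1 I (a i), forall j, atom_ok t2 e.2 J (a' j) &
      rect_integral b I J =
        (\sum_i \sum_j (a i).1 * (a' j).1 * rect_integral f (a i).2 (a' j).2)%R]) ->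
  (forall s1 s2 : R, (0 < s1)%R -> (0 < s2)%R -> net_avg f s1 s2 < +oo) ->
  net_norm p q b <= C%:E * \sum_(n <oo) \sum_(m <oo)
    ((scale e.1 n * t1) `^ (p.1)^-1 * (scale e.2 m * t2) `^ (p.2)^-1)%:E
     * net_avg f (scale e.1 n * t1) (scale e.2 m * t2).
Proof.
move=> p1 p2 q1 q2.
have inv01 (x : R) : (1 < x)%R -> (0 < x^-1 < 1)%R.
  by move=> x1; rewrite invr_gt0 (lt_trans _ x1)//= invf_lt1// (lt_trans _ x1).
have [C1 C10 H1] := dtt_norm_powR_min q1 (inv01 _ p1).
have [C2 C20 H2] := dtt_norm_powR_min q2 (inv01 _ p2).
exists (64 * (C1 * C2))%R; first by rewrite !mulr_gt0.
move=> f b e t1 t2 fi bi t10 t20 atoms fin.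
have tau0 e' n (t : R) : (0 < t)%R -> (0 < scale e' n * t)%R.
  by move=> t0; rewrite mulr_gt0// scale_gt0.
pose x n := (scale e.1 n * t1)%R; pose y m := (scale e.2 m * t2)%R.
have x0 n : (0 < x n)%R by exact: tau0.
have y0 m : (0 < y m)%R by exact: tau0.
(* Finiteness of the averages lets them be pulled out of the norm as real scalars. *)
pose c n m := fine (net_avg f (x n) (y m)).
have cE n m : (c n m)%:E = net_avg f (x n) (y m).
  by rewrite fineK// ge0_fin_numE ?net_avg_ge0// fin.
have c0 n m : (0 <= c n m)%R by rewrite fine_ge0// net_avg_ge0.
pose u n s := (s `^ (p.1)^-1 * Num.min 1 (x n / s))%R.
pose v m s := (s `^ (p.2)^-1 * Num.min 1 (y m / s))%R.
(* The one-point index fills the finite outer sum of [dtt_norm2_sum_nneseries2]. *)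
pose F (i : unit) n m s1 s2 := (64 * c n m)%:E * (u n s1 * v m s2)%:E.
have u0 n (s : R) : (0 < s)%R -> (0 <= u n s)%R by move=> s0; exact: powR_min_ge0.
have v0 m (s : R) : (0 < s)%R -> (0 <= v m s)%R by move=> s0; exact: powR_min_ge0.
have uv0 n m : ge0_pos (fun s1 s2 => (u n s1 * v m s2)%:E).
  by move=> s1 s2 s10 s20; rewrite lee_fin mulr_ge0 ?u0 ?v0.
have tensor n m := dtt_norm2_tensor q1 q2 (measurable_powR_min _ _)
  (measurable_powR_min _ _) (u0 n) (v0 m) (H1 _ (x0 n)) (H2 _ (y0 m)).
have F0 i n m : ge0_pos (F i n m).
  by move=> s1 s2 s10 s20; rewrite /F mule_ge0 ?uv0// lee_fin mulr_ge0.
have mF i n m : measurable_inner q.1 (F i n m).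
  by apply: measurable_innerZ => //; [rewrite mulr_ge0|have [] := tensor n m].
apply: (@le_trans _ _ (dtt_norm2 q (fun s1 s2 =>
    \sum_(i <- [:: tt]) \sum_(n <oo) \sum_(m <oo) F i n m s1 s2))).
  apply: le_dtt_norm2 => // [s1 s2 s10 s20|s1 s2 s10 s20].
    by rewrite mule_ge0 ?net_avg_ge0// lee_fin mulr_ge0// powR_ge0.
  rewrite big_seq1.
  have s0 : (0 <= s1 `^ (p.1)^-1 * s2 `^ (p.2)^-1)%R by rewrite mulr_ge0// powR_ge0.
  have s0' : 0 <= (s1 `^ (p.1)^-1 * s2 `^ (p.2)^-1)%:E by rewrite lee_fin.
  apply: le_trans (lee_wpmul2l s0' (net_avg_le_series fi bi t10 t20 s10 s20 atoms)) _.
  rewrite -nneseries2Zl//; last first.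
    move=> n m; rewrite mule_ge0 ?net_avg_ge0// lee_fin mulr_ge0// mulr_ge0// le_min
      ler01 divr_ge0 ?ltW// tau0//.
  rewrite le_eqVlt; apply/orP; left; apply/eqP.
  apply: eq_eseriesr => n _; apply: eq_eseriesr => m _.
  rewrite -/(x n) -/(y m) -cE /F -!EFinM; congr EFin.
  have regroup : forall a b c m1 m2 k : R,
    (a * b * (k * (m1 * m2) * c) = k * c * (a * m1 * (b * m2)))%R.
    by move=> *; ring.
  by rewrite /u /v; apply: regroup.
apply: le_trans (dtt_norm2_sum_nneseries2 q1 q2 _ mF F0) _.
rewrite big_seq1 -nneseries2Zl; last 2 first.
- by rewrite !mulr_ge0// ltW.
- by move=> n m; rewrite mule_ge0 ?net_avg_ge0// lee_fin mulr_ge0// powR_ge0.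
apply: lee_nneseries => [n _ _|n _].
  by apply: nneseries_ge0 => m _ _; exact: dtt_norm2_ge0.
apply: lee_nneseries => [m _ _|m _]; first exact: dtt_norm2_ge0.
have [mt ht] := tensor n m.
rewrite /F dtt_norm2Z ?mulr_ge0//.
apply: (@le_trans _ _ ((64 * c n m)%:E * (C1 * x n `^ (p.1)^-1 * (C2 * y m `^ (p.2)^-1))%:E)).
  by apply: lee_wpmul2l => //; rewrite lee_fin mulr_ge0.
rewrite -/(x n) -/(y m) -cE -!EFinM lee_fin le_eqVlt; apply/orP; left; apply/eqP.
have regroup2 : forall k c C1 C2 x y : R,
  (k * c * (C1 * x * (C2 * y)) = k * (C1 * C2) * (x * y * c))%R.
  by move=> *; ring.
exact: regroup2.
Qed.
End NormAtoms.

(** * The converse estimate *)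

Section InterpLeNetNorm.
Local Open Scope ereal_scope.
Context {R : realType}.

(* The geometric decay, in the distance to the grid step, left over when the
   exponent [1 / p^e] is compared with the intermediate exponent [1 / p]. *)
Definition weight (g th : R) (e : bool) : R := (2 `^ (- (g * (if e then 1 - th else th))))%R.

Lemma weight_itv (g th : R) e : (0 < g)%R -> (0 < th)%R /\ (th < 1)%R ->
  (0 <= weight g th e < 1)%R.
Proof.
move=> g0 [th0 th1]; rewrite powR_ge0/= /weight /powR ifF; last by apply/negbTE;
  rewrite pnatr_eq0.
rewrite expR_lt1 nmulr_rlt0 ?oppr_lt0; first by rewrite ln_gt0// ltr1n.
by rewrite mulr_gt0//; case: e; rewrite ?subr_gt0.
Qed.

Lemma scale_powR e n : scale e n = (2 `^ (if e then n%:R else - n%:R))%R :> R.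
Proof.
rewrite /scale; case: e; first by rewrite powR_mulrn.
by rewrite powRN powR_mulrn// exprVn.
Qed.

(** This is [interp_exponent] at the point [scale e n * t], with the prefactors kept at t. The
    mismatch is the scale to the power g (e - th), the inverse of which is the n-th power of the
    weight. *)
Lemma weight_exponent (p0 p1 p th t : R) (e : bool) (n : nat) :
  (p^-1 = (1 - th) / p0 + th / p1)%R -> (0 < t)%R ->
  let g := (p0^-1 - p1^-1)%R in
  ((t `^ g) `^ (- th) * ((t `^ g) ^+ e * (scale e n * t) `^ (if e then p1 else p0)^-1) =
   weight g th e ^+ n * (scale e n * t) `^ p^-1)%R.
Proof.
move=> hp t0 g; have S0 : (0 < scale e n :> R)%R by exact: scale_gt0.
have key : (weight g th e ^+ n * ((scale e n `^ g) `^ (- th) *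
    (scale e n `^ g) `^ (if e then 1 else 0)) = 1)%R.
  rewrite -powR_mulrn ?powR_ge0// /weight scale_powR -!powRrM.
  rewrite -!powRD; try by apply/implyP => _; rewrite pnatr_eq0.
  rewrite [X in (_ `^ X)%R](_ : _ = 0%R) ?powRr0//.
  by case: (e); ring.
rewrite [in RHS](interp_exponent e hp) ?mulr_gt0// -/g !expr_bool_powR ?powR_gt0 ?mulr_gt0//.
rewrite !powRM ?powR_ge0 ?(ltW t0) ?(ltW S0)// -[LHS]mul1r -[X in (X * _ = _)%R]key.
have regroup : forall w a b x y z : R,
  (w * (a * b) * (x * (y * z)) = w * (a * x * (b * y * z)))%R.
  by move=> *; ring.
exact: regroup.
Qed.

Variables (p0 p1 p theta : R * R) (q0 q1 q : \bar R * \bar R).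
Hypotheses (hp1 : (1 < p0.1)%R /\ (p0.1 < p1.1)%R)
  (hp2 : (1 < p0.2)%R /\ (p0.2 < p1.2)%R)
  (hq0 : 1 <= q0.1 /\ 1 <= q0.2) (hq1 : 1 <= q1.1 /\ 1 <= q1.2)
  (hq : 1 <= q.1 /\ 1 <= q.2)
  (hth1 : (0 < theta.1)%R /\ (theta.1 < 1)%R)
  (hth2 : (0 < theta.2)%R /\ (theta.2 < 1)%R)
  (hpt1 : ((p.1)^-1 = (1 - theta.1) / p0.1 + theta.1 / p1.1)%R)
  (hpt2 : ((p.2)^-1 = (1 - theta.2) / p0.2 + theta.2 / p1.2)%R).

Implicit Types (f : {mfun plane R >-> R}) (e : bool * bool).

Let g1 := ((p0.1)^-1 - (p1.1)^-1)%R.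
Let g2 := ((p0.2)^-1 - (p1.2)^-1)%R.
Let W1 := weight g1 theta.1.
Let W2 := weight g2 theta.2.

Let g10 : (0 < g1)%R. Proof. exact: gamma1_gt0 hp1. Qed.
Let g20 : (0 < g2)%R. Proof. exact: gamma2_gt0 hp2. Qed.

Lemma interp_p_ge0 : (0 <= (p.1)^-1)%R /\ (0 <= (p.2)^-1)%R.
Proof.
move: hp1 hp2 hth1 hth2 => [a1 b1] [a2 b2] [c1 d1] [c2 d2].
rewrite hpt1 hpt2; split; rewrite addr_ge0// divr_ge0 ?subr_ge0 ?(ltW c1) ?(ltW c2)
  ?(ltW d1) ?(ltW d2)//.
- exact/ltW/(lt_trans _ a1).
- by apply/ltW/(lt_trans _ b1)/(lt_trans _ a1).
- exact/ltW/(lt_trans _ a2).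
- by apply/ltW/(lt_trans _ b2)/(lt_trans _ a2).
Qed.

Let phi (f : {mfun plane R >-> R}) (t1 t2 : R) : \bar R :=
  (t1 `^ (p.1)^-1 * t2 `^ (p.2)^-1)%:E * net_avg f t1 t2.

Let phi0 f : ge0_pos (phi f).
Proof.
move=> t1 t2 _ _; rewrite /phi mule_ge0 ?net_avg_ge0//.
by rewrite lee_fin mulr_ge0// powR_ge0.
Qed.

Let series_phi f (e : bool * bool) (t1 t2 : R) : \bar R :=
  \sum_(n <oo) \sum_(m <oo) (W1 e.1 ^+ n * W2 e.2 ^+ m)%:E *
    phi f (scale e.1 n * t1) (scale e.2 m * t2).

Let W0 e (n m : nat) : (0 <= W1 e.1 ^+ n * W2 e.2 ^+ m :> R)%R.
Proof. by rewrite mulr_ge0// exprn_ge0// powR_ge0. Qed.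

Let wt : R := (\sum_(e : bool * bool) (1 - W1 e.1)^-1 * (1 - W2 e.2)^-1)%R.

Lemma nneseries_weight e : \sum_(n <oo) \sum_(m <oo) (W1 e.1 ^+ n * W2 e.2 ^+ m)%:E =
  ((1 - W1 e.1)^-1 * (1 - W2 e.2)^-1)%:E.
Proof.
under eq_eseriesr => n _.
  under eq_eseriesr do rewrite EFinM.
  rewrite nneseriesZl; last by move=> m _; rewrite lee_fin exprn_ge0// powR_ge0.
  rewrite nneseries_geometric ?weight_itv// muleC.
  over.
rewrite nneseriesZl; last by move=> m _; rewrite lee_fin exprn_ge0// powR_ge0.
by rewrite nneseries_geometric ?weight_itv// -EFinM mulrC.
Qed.

Lemma wt_gt0 : (0 < wt)%R.
Proof.
rewrite /wt -(pair_bigA _ (fun e1 e2 : bool => ((1 - W1 e1)^-1 * (1 - W2 e2)^-1)%R))/=.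
have W1lt (e : bool) : (0 < (1 - W1 e)^-1)%R.
  by rewrite invr_gt0 subr_gt0; have /andP[] := weight_itv e g10 hth1.
have W2lt (e : bool) : (0 < (1 - W2 e)^-1)%R.
  by rewrite invr_gt0 subr_gt0; have /andP[] := weight_itv e g20 hth2.
by rewrite !big_bool/= !addr_gt0// mulr_gt0.
Qed.

Lemma series_phi_atoms f e (t1 t2 : R) : (0 < t1)%R -> (0 < t2)%R ->
  ((t1 `^ g1) `^ (- theta.1) * (t2 `^ g2) `^ (- theta.2))%:E *
  (((t1 `^ g1) ^+ e.1 * (t2 `^ g2) ^+ e.2)%:E *
   \sum_(n <oo) \sum_(m <oo)
    ((scale e.1 n * t1) `^ ((mix e p0 p1).1)^-1 *
     (scale e.2 m * t2) `^ ((mix e p0 p1).2)^-1)%:E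
     * net_avg f (scale e.1 n * t1) (scale e.2 m * t2)) = series_phi f e t1 t2.
Proof.
move=> t10 t20.
have c0 n m : 0 <= ((scale e.1 n * t1) `^ ((mix e p0 p1).1)^-1 *
     (scale e.2 m * t2) `^ ((mix e p0 p1).2)^-1)%:E
     * net_avg f (scale e.1 n * t1) (scale e.2 m * t2).
  by rewrite mule_ge0 ?net_avg_ge0// lee_fin mulr_ge0// powR_ge0.
rewrite -nneseries2Zl//; last by rewrite mulr_ge0// exprn_ge0// powR_ge0.
rewrite -nneseries2Zl; last 2 first.
- by rewrite mulr_ge0// powR_ge0.
- by move=> n m; rewrite mule_ge0// lee_fin mulr_ge0// exprn_ge0// powR_ge0.
apply: eq_eseriesr => n _; apply: eq_eseriesr => m _.
rewrite /phi !muleA -!EFinM; congr (_%:E * _).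
have H1 := weight_exponent e.1 n hpt1 t10.
have H2 := weight_exponent e.2 m hpt2 t20.
rewrite -/g1 in H1; rewrite -/g2 in H2.
have regroup : forall u v x y : R,
  (u * v * (x * y) = (u * x) * (v * y))%R.
  by move=> *; ring.
rewrite [RHS](regroup (W1 e.1 ^+ n)%R _ _ _) -H1 -H2.
have regroup2 : forall a b c d x y : R,
  (a * b * (c * d) * (x * y) = a * (c * x) * (b * (d * y)))%R.
  by move=> *; ring.
exact: regroup2.
Qed.

(** [phi f] is bounded by a multiple of the net norm, and the weights are summable. The finiteness
    is what places the pieces in the endpoint spaces. *)
Lemma series_phi_lty f e (t1 t2 : R) : net_norm p q f < +oo ->
  (0 < t1)%R -> (0 < t2)%R -> series_phi f e t1 t2 < +oo.
Proof.
move=> ffin t10 t20; have [a b] := interp_p_ge0; have [h1 h2] := hq.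
have [C C0 HC] := nonincreasing_le_dtt_norm2 h1 h2 a b.
have fN : net_norm p q f \is a fin_num by rewrite ge0_fin_numE// net_norm_ge0.
pose B := (C * fine (net_norm p q f))%R.
have B0 : (0 <= B)%R by rewrite mulr_ge0 ?(ltW C0)// fine_ge0// net_norm_ge0.
have phiB (s1 s2 : R) : (0 < s1)%R -> (0 < s2)%R -> phi f s1 s2 <= B%:E.
  move=> s10 s20; rewrite /B EFinM fineK//; apply: HC => //.
  - by move=> ? ? _ _; exact: net_avg_ge0.
  - by move=> s _ u v _ uv; exact: net_avg_nonincreasing.
  - by move=> s _ u v _ uv; exact: net_avg_nonincreasing.
apply: (@le_lt_trans _ _ (B%:E * \sum_(n <oo) \sum_(m <oo) (W1 e.1 ^+ n * W2 e.2 ^+ m)%:E)).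
  rewrite -nneseries2Zl//; last by move=> n m; rewrite lee_fin.
  apply: lee_nneseries => [n _ _|n _].
    apply: nneseries_ge0 => m _ _; rewrite mule_ge0 ?lee_fin//.
    by apply: phi0; rewrite mulr_gt0// scale_gt0.
  apply: lee_nneseries => [m _ _|m _].
    rewrite mule_ge0 ?lee_fin//; by apply: phi0; rewrite mulr_gt0// scale_gt0.
  rewrite muleC; apply: lee_wpmul2r; first by rewrite lee_fin.
  by apply: phiB; rewrite mulr_gt0// scale_gt0.
by rewrite nneseries_weight -EFinM ltry.
Qed.

Lemma net_avg_lty f (s1 s2 : R) : net_norm p q f < +oo ->
  (0 < s1)%R -> (0 < s2)%R -> net_avg f s1 s2 < +oo.
Proof.
move=> ffin s10 s20; have [a b] := interp_p_ge0; have [h1 h2] := hq.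
have [C C0 HC] := nonincreasing_le_dtt_norm2 h1 h2 a b.
have c0 : (0 < s1 `^ (p.1)^-1 * s2 `^ (p.2)^-1)%R by rewrite mulr_gt0// powR_gt0.
rewrite ltey; apply/eqP => fE.
have := HC (net_avg f) _ _ _ s1 s2 s10 s20; rewrite fE gt0_muley ?lte_fin//.
rewrite leye_eq => /(_ _ _ _)/eqP fy.
have : C%:E * net_norm p q f < +oo by rewrite lte_mul_pinfty// lee_fin ltW.
rewrite fy ?ltxx//.
- by move=> ? ? _ _; exact: net_avg_ge0.
- by move=> s _ u v _ uv; exact: net_avg_nonincreasing.
- by move=> s _ u v _ uv; exact: net_avg_nonincreasing.
Qed.

(** The grid has steps [t1] and [t2], whereas the K-functional is taken at t_i^(g_i); a new
    decomposition is chosen for each t, with one constant for all. *)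
Lemma exists_decomposition : exists2 C : R, (0 < C)%R &
  forall f, net_space p q f -> forall t1 t2 : R, (0 < t1)%R -> (0 < t2)%R ->
  exists b, decomposition p0 p1 q0 q1 f b /\
    ((t1 `^ g1) `^ (- theta.1) * (t2 `^ g2) `^ (- theta.2))%:E *
    \sum_(e : bool * bool) ((t1 `^ g1) ^+ e.1 * (t2 `^ g2) ^+ e.2)%:E *
      net_norm (mix e p0 p1) (mix e q0 q1) (b e) <=
    C%:E * \sum_(e : bool * bool) series_phi f e t1 t2.
Proof.
have /choice[C HC] : forall e : bool * bool, exists C : R, (0 < C)%R /\
  forall (f b : {mfun plane R >-> R}) (t1 t2 : R),
  integrable_on_rects f -> integrable_on_rects b ->
  (0 < t1)%R -> (0 < t2)%R ->
  (forall I J, exists a a' : 'I_4 -> R * segment R,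
    [/\ forall i, atom_ok t1 e.1 I (a i), forall j, atom_ok t2 e.2 J (a' j) &
      rect_integral b I J =
        (\sum_i \sum_j (a i).1 * (a' j).1 * rect_integral f (a i).2 (a' j).2)%R]) ->
  (forall s1 s2 : R, (0 < s1)%R -> (0 < s2)%R -> net_avg f s1 s2 < +oo) ->
  net_norm (mix e p0 p1) (mix e q0 q1) b <= C%:E * \sum_(n <oo) \sum_(m <oo)
    ((scale e.1 n * t1) `^ ((mix e p0 p1).1)^-1 *
      (scale e.2 m * t2) `^ ((mix e p0 p1).2)^-1)%:E
     * net_avg f (scale e.1 n * t1) (scale e.2 m * t2).
  move=> e; have [m1 m2] := mix_q_ge1 hq0 hq1 e; have [n1 n2] := mix_p_gt1 hp1 hp2 e.
  have [C C0 HC] := net_norm_le_series n1 n2 m1 m2.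
  by exists C; split=> // f b t1 t2 *; exact: HC.
pose B := (\sum_e C e)%R.
have CB e : (C e <= B)%R.
  by rewrite /B (bigD1 e)//= lerDl sumr_ge0// => e' _; apply/ltW; exact: (HC e').1.
have B0 : (0 < B)%R by exact: lt_le_trans (HC (true, true)).1 (CB _).
exists B => // f [fi ffin] t1 t2 t10 t20.
have [b [bE bP]] := exists_split fi t10 t20.
pose x1 := (t1 `^ g1)%R; pose x2 := (t2 `^ g2)%R.
pose D := (x1 `^ (- theta.1) * x2 `^ (- theta.2))%R.
have D0 : (0 < D)%R by rewrite mulr_gt0// !powR_gt0.
have xe0 (e : bool * bool) : (0 < x1 ^+ e.1 * x2 ^+ e.2)%R.
  by rewrite mulr_gt0// exprn_gt0// powR_gt0.
pose S (e : bool * bool) := \sum_(n <oo) \sum_(m <oo)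
    ((scale e.1 n * t1) `^ ((mix e p0 p1).1)^-1 *
      (scale e.2 m * t2) `^ ((mix e p0 p1).2)^-1)%:E
     * net_avg f (scale e.1 n * t1) (scale e.2 m * t2).
have S0 e : 0 <= S e.
  apply: nneseries_ge0 => n _ _; apply: nneseries_ge0 => m _ _.
  by rewrite mule_ge0 ?net_avg_ge0// lee_fin mulr_ge0// powR_ge0.
have SE e : D%:E * ((x1 ^+ e.1 * x2 ^+ e.2)%:E * S e) = series_phi f e t1 t2.
  exact: series_phi_atoms.
have bS e : net_norm (mix e p0 p1) (mix e q0 q1) (b e) <= (C e)%:E * S e.
  have [bi ba] := bP e; apply: (HC e).2 => // s1 s2 s10 s20.
  exact: net_avg_lty.
(* A positive multiple of [S e] is the finite [series_phi f e t1 t2]. *)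
have Sfin e : S e < +oo.
  have : D%:E * ((x1 ^+ e.1 * x2 ^+ e.2)%:E * S e) < +oo by rewrite SE; exact: series_phi_lty.
  rewrite muleA -EFinM; apply: contraTT; rewrite -!leNgt !leye_eq => /eqP ->.
  by rewrite gt0_muley// lte_fin mulr_gt0.
exists b; split.
  split.
    move=> e; have [bi _] := bP e; split=> //.
    apply: le_lt_trans (bS e) _; rewrite lte_mul_pinfty// ?lee_fin//.
    exact/ltW/(HC e).1.
  exact: aeW.
rewrite -/x1 -/x2 -/D.
rewrite ge0_sume_distrr; last first.
  by move=> e _; rewrite mule_ge0 ?net_norm_ge0// lee_fin ltW.
rewrite ge0_sume_distrr; last first.
  move=> e _; rewrite -SE mule_ge0 ?lee_fin ?(ltW D0)// mule_ge0// lee_fin ltW//.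
apply: lee_sum => e _; rewrite -SE.
apply: (@le_trans _ _ (D%:E * ((x1 ^+ e.1 * x2 ^+ e.2)%:E * (B%:E * S e)))).
  apply: lee_wpmul2l; first by rewrite lee_fin ltW.
  apply: lee_wpmul2l; first by rewrite lee_fin ltW.
  apply: le_trans (bS e) _; apply: lee_wpmul2r => //.
  by rewrite lee_fin.
by rewrite [X in _ * X <= _]muleCA [X in X <= _]muleCA.
Qed.

Lemma interp_le_net_norm : exists2 C : R, (0 < C)%R &
  forall f, net_space p q f ->
  interp_norm p0 p1 q0 q1 theta q f <= C%:E * net_norm p q f.
Proof.
have [C C0 HC] := exists_decomposition; have [h1 h2] := hq.
have [c c0 Hc] := dtt_norm2_dilate h1 h2 g10 g20.
have [d d0 Hd] := dtt_norm2_dilate h1 h2 (@ltr01 R) (@ltr01 R).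
(* Here [c] comes from t -> t^g, [C] from the decomposition, [wt] is the total mass of the weights
   over the four pieces, and 1/d is the cost of a dilation. *)
exists (c * (C * wt * d^-1))%R; first by rewrite !mulr_gt0 ?invr_gt0// wt_gt0.
move=> f fN; rewrite /interp_norm.
set Phi := (X in dtt_norm2 q X).
have Phi0 : ge0_pos Phi.
  move=> t1 t2 t10 t20; rewrite /Phi mule_ge0 ?lee_fin ?mulr_ge0 ?powR_ge0//.
  exact: K_functional_ge0.
have mPhi : measurable_inner q.1 Phi.
  apply: monotone_measurable_inner => //; first exact: K_functional_ge0.
  exact: K_functional_monotone.
rewrite (Hc _ 1%R 1%R)// EFinM -muleA; apply: lee_wpmul2l; first by rewrite lee_fin ltW.
have mphi : measurable_inner q.1 (phi f).
  apply: monotone_measurable_inner => //; last exact: net_avg_monotone.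
  by move=> ? ? _ _; exact: net_avg_ge0.
pose G (e : bool * bool) n m t1 t2 := (C * (W1 e.1 ^+ n * W2 e.2 ^+ m))%:E *
   phi f (scale e.1 n * t1 `^ 1)%R (scale e.2 m * t2 `^ 1)%R.
have sc0 (e : bool) n (t : R) : (0 < t)%R -> (0 < scale e n * t `^ 1)%R.
  by move=> t0; rewrite mulr_gt0 ?scale_gt0 ?powR_gt0.
have CW0 e n m : (0 <= C * (W1 e.1 ^+ n * W2 e.2 ^+ m))%R.
  by rewrite mulr_ge0// ltW.
have dphi0 (e : bool * bool) n m : ge0_pos (fun t1 t2 : R =>
    phi f (scale e.1 n * t1 `^ 1)%R (scale e.2 m * t2 `^ 1)%R).
  by move=> t1 t2 t10 t20; apply: phi0; exact: sc0.
have G0 e n m : ge0_pos (G e n m).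
  by move=> t1 t2 t10 t20; rewrite mule_ge0 ?lee_fin//; exact: dphi0.
(* Once the powers of the scales are extracted, a dilate of [phi f] is again a product of powers
   times a monotone function. *)
have mdphi (e : bool * bool) n m : measurable_inner q.1 (fun t1 t2 : R =>
    phi f (scale e.1 n * t1 `^ 1)%R (scale e.2 m * t2 `^ 1)%R).
  apply: (@eq_measurable_inner R _ (fun t1 t2 => (t1 `^ (p.1)^-1 * t2 `^ (p.2)^-1)%:E *
    (((scale e.1 n) `^ (p.1)^-1 * (scale e.2 m) `^ (p.2)^-1)%:E *
      net_avg f (scale e.1 n * t1) (scale e.2 m * t2)))).
    move=> t1 t2 t10 t20; rewrite /phi !powRr1 ?(ltW t10) ?(ltW t20)//.
    rewrite muleA -EFinM; congr (_%:E * _).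
    rewrite !powRM ?(ltW t10) ?(ltW t20) ?(ltW (scale_gt0 _ _))//.
    have regroup : forall a b x y : R,
      (a * b * (x * y) = (x * a) * (y * b))%R.
      by move=> *; ring.
    exact: regroup.
  have k0 : (0 <= (scale e.1 n) `^ (p.1)^-1 * (scale e.2 m) `^ (p.2)^-1 :> R)%R.
    by rewrite mulr_ge0// powR_ge0.
  apply: monotone_measurable_inner => //.
    by move=> t1 t2 _ _; rewrite mule_ge0 ?net_avg_ge0// lee_fin.
  right => t2 s t _ _ st; split; apply: lee_wpmul2l; rewrite ?lee_fin//;
    by apply: net_avg_nonincreasing => //; rewrite ler_pM2l// scale_gt0.
have mG e n m : measurable_inner q.1 (G e n m).
  exact: measurable_innerZ h1 (CW0 e n m) (dphi0 e n m) (mdphi e n m).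
apply: (@le_trans _ _ (dtt_norm2 q (fun t1 t2 =>
  \sum_(e : bool * bool) \sum_(n <oo) \sum_(m <oo) G e n m t1 t2))).
  apply: le_dtt_norm2 => // [t1 t2 t10 t20|t1 t2 t10 t20].
    by rewrite !mul1r; apply: Phi0; rewrite powR_gt0.
  rewrite !mul1r; have [b [bdec bN]] := HC f fN t1 t2 t10 t20.
  have D0 : 0 <= ((t1 `^ g1) `^ (- theta.1) * (t2 `^ g2) `^ (- theta.2))%:E.
    by rewrite lee_fin mulr_ge0// powR_ge0.
  apply: le_trans (lee_wpmul2l D0 (K_functional_ub _ _ bdec)) _.
  apply: le_trans bN _; rewrite ge0_sume_distrr; last first.
    move=> e _; apply: nneseries_ge0 => n _ _; apply: nneseries_ge0 => m _ _.
    by rewrite mule_ge0 ?lee_fin//; apply: phi0; rewrite mulr_gt0// scale_gt0.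
  apply: lee_sum => e _; rewrite /series_phi -nneseries2Zl ?(ltW C0)//; last first.
    by move=> n m; rewrite mule_ge0 ?lee_fin//; apply: phi0; rewrite mulr_gt0// scale_gt0.
  rewrite le_eqVlt; apply/orP; left; apply/eqP.
  apply: eq_eseriesr => n _; apply: eq_eseriesr => m _.
  by rewrite muleA -EFinM /G !powRr1 ?(ltW t10) ?(ltW t20).
apply: le_trans (dtt_norm2_sum_nneseries2 h1 h2 _ mG G0) _.
have dE (e : bool * bool) n m : dtt_norm2 q (G e n m) =
    (C * d^-1)%:E * net_norm p q f * (W1 e.1 ^+ n * W2 e.2 ^+ m)%:E.
  rewrite /G (dtt_norm2Z h1 h2 (CW0 e n m) (dphi0 e n m) (mdphi e n m)).
  rewrite /net_norm -/(phi f) (Hd _ _ _ (scale_gt0 e.1 n) (scale_gt0 e.2 m) (phi0 f) mphi).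
  rewrite muleA -EFinM -[(C / d * d)%R]mulrA mulVf ?gt_eqF// mulr1.
  by rewrite muleAC -EFinM.
have K0 : 0 <= (C * d^-1)%:E * net_norm p q f.
  by rewrite mule_ge0 ?net_norm_ge0// lee_fin mulr_ge0 ?invr_ge0// ltW.
have Kfin : (C * d^-1)%:E * net_norm p q f \is a fin_num.
  rewrite ge0_fin_numE// lte_mul_pinfty// ?lee_fin ?mulr_ge0 ?invr_ge0 ?(ltW C0) ?(ltW d0)//.
  by case: fN.
rewrite (_ : (C * wt * d^-1)%:E * _ = (C * d^-1)%:E * net_norm p q f * wt%:E); last first.
  by rewrite muleAC -EFinM mulrAC.
rewrite /wt -sumEFin ge0_sume_distrr; last first.
  by move=> e _; rewrite -nneseries_weight; apply: nneseries_ge0 => n _ _;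
    apply: nneseries_ge0 => m _ _; rewrite lee_fin.
apply: lee_sum => e _; rewrite -nneseries_weight -(fineK Kfin) -nneseries2Zl ?fine_ge0//;
  last first.
  by move=> n m; rewrite lee_fin.
rewrite le_eqVlt; apply/orP; left; apply/eqP.
by apply: eq_eseriesr => n _; apply: eq_eseriesr => m _; rewrite dE fineK.
Qed.

End InterpLeNetNorm.

Theorem theorem1 (R : realType) (p0 p1 p theta : R * R)
    (q0 q1 q : \bar R * \bar R)
    (hp1 : 1 < p0.1 /\ p0.1 < p1.1) (hp2 : 1 < p0.2 /\ p0.2 < p1.2)
    (hq0 : (1 <= q0.1)%E /\ (1 <= q0.2)%E)
    (hq1 : (1 <= q1.1)%E /\ (1 <= q1.2)%E)
    (hq : (1 <= q.1)%E /\ (1 <= q.2)%E)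
    (htheta1 : 0 < theta.1 /\ theta.1 < 1)
    (htheta2 : 0 < theta.2 /\ theta.2 < 1)
    (hpt1 : (p.1)^-1 = (1 - theta.1) / p0.1 + theta.1 / p1.1)
    (hpt2 : (p.2)^-1 = (1 - theta.2) / p0.2 + theta.2 / p1.2) :
  interp_space p0 p1 q0 q1 theta q = net_space p q /\
  equivalent_norms (net_space p q)
    (interp_norm p0 p1 q0 q1 theta q) (net_norm p q).
Proof.
have [C C0 HC] := net_norm_le_interp hp1 hp2 hq0 hq1 hq hpt1 hpt2.
have [D D0 HD] := interp_le_net_norm hp1 hp2 hq0 hq1 hq htheta1 htheta2 hpt1 hpt2.
split.
  apply/seteqP; split=> a.
    move=> [[b [ib ab]] afin]; split.
      by have [] := integrable_on_rects_ae (fun e => (ib e).1) ab.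
    by apply: le_lt_trans (HC a) _; rewrite lte_mul_pinfty// lee_fin ltW.
  move=> aN; split; last first.
    apply: le_lt_trans (HD a aN) _; rewrite lte_mul_pinfty// ?lee_fin ?ltW//.
    by case: aN.
  (* Membership in the sum of the four spaces needs only one decomposition; the one with both grid
     steps equal to 1 is taken. *)
  have [E _ HE] := exists_decomposition hp1 hp2 hq0 hq1 hq htheta1 htheta2 hpt1 hpt2.
  by have [b [ab _]] := HE a aN 1 1 ltr01 ltr01; exists b.
exists D^-1, C; split=> //; first by rewrite invr_gt0.
move=> a aN; split; last exact: HC.
by rewrite lee_pdivrMl//; exact: HD.
Qed.
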